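(* Let $\mathbb{F}$ be a field and let $M$ be an acyclic matrix over $\mathbb{F}$ with zero diagonal, i.e. $M\in\mathcal{M}_{\mathbb{F},0}(F)$ for some forest $F$. The following procedure outputs a sparsest basis $\mathcal{B}_M$ of $\mathrm{Null}(M)$: (1) input $M$; (2) find the forest $F$ such that $M\in\mathcal{M}_{\mathbb{F},0}(F)$; (3) using the known algorithms for forests described in the context, find a sparsest basis $\mathcal{B}_F$ of $\mathrm{Null}(A(F))$ and the null support $\mathrm{Supp}(A(F))$; (4) find the connected components of $F$; (5) for each connected component $T_i$ of $F$ with $\mathrm{Supp}(A(T_i))\neq\emptyset$ choose a vertex $v_i\in\mathrm{Supp}(A(T_i))$; (6) let $U$ be the set of the chosen $v_i$ and calculate $(D^{(M,U)})^{-1}$; (7) calculate $\mathcal{B}_M=(D^{(M,U)})^{-1}\mathcal{B}_F=\{(D^{(M,U)})^{-1}\vec{b}:\vec{b}\in\mathcal{B}_F\}$; (8) output $\mathcal{B}_M$. In particular, a sparsest basis of $\mathrm{Null}(A(F))$ yields a sparsest basis of $\mathrm{Null}(M)$ once it is multiplied by $(D^{(M,U)})^{-1}$, and a sparsest basis of $\mathrm{Null}(M)$ can be found in optimal time.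
   Context: All graphs are finite, undirected, without loops or multiple edges. $\mathbb{F}$ is an arbitrary field. For a graph $G$, $\mathcal{M}_{\mathbb{F},0}(G)$ is the set of all (not necessarily symmetric) matrices $M$ over $\mathbb{F}$ with rows and columns indexed by $V(G)$, with all diagonal entries zero, and such that for distinct $u,w\in V(G)$ the entry $M_{u,w}$ is nonzero if and only if $\{u,w\}\in E(G)$. $A(G)$ is the adjacency matrix of $G$, viewed as a $(0,1)$-matrix over $\mathbb{F}$. $\mathrm{Null}(M)$ is the null space of $M$. The null support $\mathrm{Supp}(M)$ is the set of vertices $w\in V(G)$ such that some $\vec{x}\in\mathrm{Null}(M)$ has $\vec{x}_w\neq 0$. A sparsest basis of a subspace is a basis with the fewest nonzero entries. For vertices $v,w$ in the same connected component of a forest $F$, $vPw$ denotes the unique directed path from $v$ to $w$; $(a,b)\in vPw$ means that $a,b$ are consecutive vertices of this path with $a$ preceding $b$. For $M\in\mathcal{M}_{\mathbb{F},0}(F)$ and $v\in V(F)$, $D^{(M,v)}$ is the non-singular diagonal matrix with $$D^{(M,v)}_{w,w}=\prod_{\substack{u\in\mathrm{Supp}(M)\\ (u,t)\in vPw}}M_{u,t}^{-1}\ \prod_{\substack{u\in\mathrm{Supp}(M)\\ (t,u)\in vPw}}M_{t,u}$$ for $w$ in the same component as $v$ (empty products equal $1$), and $D^{(M,v)}_{w,w}=1$ if $v$ and $w$ lie in different components. For a set $U\subset V(F)$ with at most one vertex in each connected component of $F$, $D^{(M,U)}$ is the non-singular diagonal matrix with $D^{(M,U)}_{w,w}=\prod_{v\in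 U}D^{(M,v)}_{w,w}$. The known algorithms for forests referred to in step (3) find the null support of the adjacency matrix of a forest in linear time, and a sparsest basis of its null space, with entries in $\{-1,0,1\}$, in optimal time.
   Formalization: In the definition of D^{(M,v)} the first product uses M_{t,u}^{-1} in place of the printed M_{u,t}^{-1}, since the printed formula makes the claim false for non-symmetric M (path 0-1-2, M_{10}=2, other edge entries 1); the two agree for symmetric M. *)

(* Defs.v *)
From HB Require Import structures.
From mathcomp Require Import all_boot all_order all_algebra.
From mathcomp Require Import boolp.

Set Implicit Arguments.
Unset Strict Implicit.
Unset Printing Implicit Defensive.

Import GRing.Theory.
Local Open Scope ring_scope.

Record graph (n : nat) := Graph {
  adj : rel 'I_n;
  adj_sym : symmetric adj;
  adj_irr : irreflexive adj }.

(* [ucycleb] also accepts the closed walks x and x, y, hence the size bound. *)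
Definition forest n (G : graph n) : Prop :=
  forall c : seq 'I_n, (2 < size c)%N -> ~~ ucycleb (adj G) c.

Definition components n (G : graph n) : {set {set 'I_n}} :=
  equivalence_partition (connect (adj G)) [set: 'I_n].

(* The subgraph induced on C; its vertex i : 'I_#|C| stands for the vertex
   [enum_val i] of G. *)
Definition induced n (G : graph n) (C : {set 'I_n}) : graph #|C| :=
  @Graph #|C| (fun i j => adj G (enum_val i) (enum_val j))
    (fun i j => adj_sym G (enum_val i) (enum_val j))
    (fun i => adj_irr G (enum_val i)).

(* [simple_path G v w p]: the vertices of p, in order and after v, form a path
   without repeated vertices from v to w. *)
Definition simple_path n (G : graph n) (v w : 'I_n) (p : seq 'I_n) : bool :=
  [&& path (adj G) v p, last v p == w & uniq (v :: p)].

(* (a, b) is an arc of the directed path vPw. In a forest there is at most one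
   simple path from v to w, and none if they lie in different components. *)
Definition on_path n (G : graph n) (v w a b : 'I_n) : bool :=
  `[< exists2 p, simple_path G v w p & infix [:: a; b] (v :: p) >].

Section Matrices.
Variable K : fieldType.

Definition adjmx n (G : graph n) : 'M[K]_n := \matrix_(u, w) (adj G u w)%:R.

Definition in_M0 n (G : graph n) (M : 'M[K]_n) : Prop :=
  (forall u, M u u = 0) /\
  (forall u w, u != w -> M u w != 0 <-> adj G u w).

Definition acyclic_mx n (M : 'M[K]_n) : Prop :=
  exists2 G : graph n, forest G & in_M0 G M.

Definition forest_adjmx n (M : 'M[K]_n) : Prop :=
  exists2 G : graph n, forest G & M = adjmx G.

Definition Null n (M : 'M[K]_n) : {vspace 'cV[K]_n} :=
  lker (linfun (mulmx M : 'cV[K]_n -> 'cV[K]_n)).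

Definition Supp n (M : 'M[K]_n) : {set 'I_n} :=
  [set w | `[< exists2 x, x \in Null M & x w 0 != 0 >]].

(* Supp(A(C)) for the subgraph induced on C, as a set of vertices of G. *)
Definition Supp_adj n (G : graph n) (C : {set 'I_n}) : {set 'I_n} :=
  enum_val @: Supp (adjmx (induced G C)).

(* U consists of one vertex of Supp(A(T)) for each component T of G for which
   this set is nonempty. *)
Definition choice_of_roots n (G : graph n) (U : {set 'I_n}) : Prop :=
  forall T, T \in components G ->
    if Supp_adj G T == set0 then U :&: T = set0
    else exists2 v, v \in Supp_adj G T & U :&: T = [set v].

Definition nnz n (B : seq 'cV[K]_n) : nat :=
  (\sum_(b <- B) #|[set i | b i 0%R != 0%R]|)%N.

Definition sparsest_basis n (W : {vspace 'cV[K]_n}) (B : seq 'cV[K]_n) : Prop :=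
  basis_of W B /\ forall B', basis_of W B' -> (nnz B <= nnz B')%N.

(* For u in Supp(M) and t its predecessor or successor on vPw, both factors are
   taken from row t of M. The first one is not M_{u,t}^-1: for the path 0 - 1 - 2
   and v = 0, a null vector satisfies M_{1,0} x_0 + M_{1,2} x_2 = 0, so D_{2,2}
   has to be M_{1,0}^-1 * M_{1,2}. The two readings agree when M is symmetric.
   If v and w lie in different components, both products are empty. *)
Definition Dcoef n (M : 'M[K]_n) (G : graph n) (v w : 'I_n) : K :=
  (\prod_(u in Supp M) \prod_(t | on_path G v w u t) (M t u)^-1) *
  (\prod_(u in Supp M) \prod_(t | on_path G v w t u) M t u).

Definition Dvertex n (M : 'M[K]_n) (G : graph n) (v : 'I_n) : 'M[K]_n :=
  diag_mx (\row_w Dcoef M G v w).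

Definition Dset n (M : 'M[K]_n) (G : graph n) (U : {set 'I_n}) : 'M[K]_n :=
  diag_mx (\row_w \prod_(v in U) Dvertex M G v w w).

Lemma on_path_adj n (G : graph n) v w a b : on_path G v w a b -> adj G a b.
Proof.
move=> /asboolP[p /and3P[pp _ _]] /infixP[s1 [s2 E]].
case: s1 E => [|x s1] /= [vE pE]; first by move: pp; rewrite pE vE => /andP[].
by move: pp; rewrite pE cat_path /= => /and3P[_ _ /andP[]].
Qed.

Lemma Dset_unitmx n (M : 'M[K]_n) (G : graph n) (U : {set 'I_n}) :
  in_M0 G M -> Dset M G U \in unitmx.
Proof.
move=> [_ MG].
have nz a b : adj G a b -> M a b != 0.
  move=> Gab; rewrite MG //; apply: contraL Gab => /eqP ->.
  by rewrite adj_irr.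
rewrite unitmxE det_diag unitfE; apply/prodf_neq0 => w _; rewrite mxE.
apply/prodf_neq0 => v _; rewrite !mxE eqxx mulr1n mulf_neq0 //.
  apply/prodf_neq0 => u _; apply/prodf_neq0 => t /on_path_adj Gut.
  by rewrite invr_eq0 nz // adj_sym.
by apply/prodf_neq0 => u _; apply/prodf_neq0 => t /on_path_adj /nz.
Qed.

(* Running time is measured on a unit-cost random access machine over K, given
   as a while-language. A store holds infinitely many arrays of natural numbers
   and infinitely many arrays of field elements, both named by natural numbers.
   Index arithmetic is limited to addition and truncated subtraction. *)

Record store := Store {
  nats : nat -> nat -> nat;
  scals : nat -> nat -> K }.

Inductive nexp :=
  | NConst of nat
  | NGet of nat & nexp
  | NAdd of nexp & nexp
  | NSub of nexp & nexp.

Inductive fexp :=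
  | FZero
  | FOne
  | FGet of nat & nexp
  | FAdd of fexp & fexp
  | FOpp of fexp
  | FMul of fexp & fexp
  | FInv of fexp.

Inductive test :=
  | TLt of nexp & nexp
  | TZero of fexp.

Inductive cmd :=
  | Skip
  | NSet of nat & nexp & nexp
  | FSet of nat & nexp & fexp
  | Seq of cmd & cmd
  | If of test & cmd & cmd
  | While of test & cmd.

Fixpoint neval (s : store) (e : nexp) : nat :=
  match e with
  | NConst k => k
  | NGet a i => nats s a (neval s i)
  | NAdd e1 e2 => (neval s e1 + neval s e2)%N
  | NSub e1 e2 => (neval s e1 - neval s e2)%N
  end.

Fixpoint feval (s : store) (e : fexp) : K :=
  match e with
  | FZero => 0
  | FOne => 1
  | FGet a i => scals s a (neval s i)
  | FAdd e1 e2 => feval s e1 + feval s e2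
  | FOpp e1 => - feval s e1
  | FMul e1 e2 => feval s e1 * feval s e2
  | FInv e1 => (feval s e1)^-1
  end.

Definition teval (s : store) (b : test) : bool :=
  match b with
  | TLt e1 e2 => (neval s e1 < neval s e2)%N
  | TZero e => feval s e == 0
  end.

Definition upd (T : Type) (m : nat -> nat -> T) (a i : nat) (x : T) :=
  fun a' i' => if (a' == a) && (i' == i) then x else m a' i'.

(* [exec c s t s']: c, started in s, halts in s' after t steps. Expressions are
   charged one step regardless of their size: a program contains finitely many
   of them, so this affects running times by a constant factor only. *)
Inductive exec : cmd -> store -> nat -> store -> Prop :=
  | exec_Skip s : exec Skip s 1 s
  | exec_NSet a i e s :
      exec (NSet a i e) s 1
        (Store (upd (nats s) a (neval s i) (neval s e)) (scals s))
  | exec_FSet a i e s :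
      exec (FSet a i e) s 1
        (Store (nats s) (upd (scals s) a (neval s i) (feval s e)))
  | exec_Seq c1 c2 s1 s2 s3 t1 t2 :
      exec c1 s1 t1 s2 -> exec c2 s2 t2 s3 -> exec (Seq c1 c2) s1 (t1 + t2) s3
  | exec_If_true b c1 c2 s s' t :
      teval s b -> exec c1 s t s' -> exec (If b c1 c2) s t.+1 s'
  | exec_If_false b c1 c2 s s' t :
      ~~ teval s b -> exec c2 s t s' -> exec (If b c1 c2) s t.+1 s'
  | exec_While_false b c s :
      ~~ teval s b -> exec (While b c) s 1 s
  | exec_While_true b c s1 s2 s3 t1 t2 :
      teval s1 b -> exec c s1 t1 s2 -> exec (While b c) s2 t2 s3 ->
      exec (While b c) s1 (t1 + t2).+1 s3.

(* Positions of the nonzero entries of M, in row-major order. *)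
Definition nz_pos n (M : 'M[K]_n) : seq ('I_n * 'I_n) :=
  [seq p <- [seq (i, j) | i <- enum 'I_n, j <- enum 'I_n] | M p.1 p.2 != 0].

(* Input in compressed sparse row format: n, the n+1 row offsets, then the
   column indices and the values of the nonzero entries. For M in the class
   [in_M0 G] these are the adjacency lists of G, weighted by M. All other cells
   are zero. *)
Definition encode n (M : 'M[K]_n) : store :=
  Store
    (fun a => nth 0%N (nth [::]
       [:: [:: n];
           [seq count (fun p : 'I_n * 'I_n => (p.1 < i)%N) (nz_pos M)
              | i <- iota 0 n.+1];
           [seq nat_of_ord p.2 | p <- nz_pos M]] a))
    (fun a => nth 0 (nth [::] [:: [seq M p.1 p.2 | p <- nz_pos M]] a)).

(* Output in coordinate format: the number of basis vectors and the number of
   nonzero entries, then for each nonzero entry the index of its vector, its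
   coordinate and its value, in any order and each exactly once. *)
Definition output n (s : store) (B : seq 'cV[K]_n) : Prop :=
  nats s 3 0 = size B /\
  perm_eq [seq (nats s 4 e, nats s 5 e, scals s 1 e) | e <- iota 0 (nats s 3 1)]
          [seq p <- [seq (j, nat_of_ord i, (B`_j : 'cV[K]_n) i 0)
                       | j <- iota 0 (size B), i <- enum 'I_n] | p.2 != 0].

(* P finds sparsest bases of null spaces of the matrices in cls in optimal
   time, that is, in time at most proportional to the number of vertices plus
   the number of nonzero entries to be written. The successor accounts for
   n = 0. *)
Definition finds_sparsest_basis_in_optimal_time
    (cls : forall n, 'M[K]_n -> Prop) (P : cmd) : Prop :=
  exists c : nat, forall (n : nat) (M : 'M[K]_n), cls n M ->
    exists t s B,
      [/\ exec P (encode M) t s, output s B, sparsest_basis (Null M) B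
        & (t <= c * (n + nnz B).+1)%N].

End Matrices.

(* Main.v *)
Require Import Defs.
From HB Require Import structures.
From mathcomp Require Import all_boot all_order all_algebra.
From mathcomp Require Import boolp.
From mathcomp Require Import zify.

(* Removing leaves one at a time shows that for a forest F every M in M_0(F) has
   the form M = R A(F) C with invertible diagonal R and C. Hence
   Null M = C^-1 Null A(F), all such M have the same null support, and scaling by
   a diagonal matrix preserves sparsest bases.

   The matrix D = D^(M,U) is in general not of the form k C, but it behaves like
   C around every vertex t outside the support: D_u = D_t M_tu for all neighbours
   u of t in the support. Since no two vertices of the support are adjacent, the
   equations of M y = 0 at such t are all there is, so D also carries Null M onto
   Null A(F).

   For the running time, C is computed directly by a breadth-first search of F,
   which needs both M_wx and M_xw when it crosses the edge wx; the latter are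
   obtained beforehand by a linear-time transposition. The entries of M are then
   overwritten by 1, the given program is run with its arrays renamed away from
   the working arrays, and its output is multiplied by C^-1. *)

Set Implicit Arguments.
Unset Strict Implicit.
Unset Printing Implicit Defensive.

Import GRing.Theory.
Local Open Scope ring_scope.

(** * Forests *)

Section DeleteEdge.
Variables (n : nat) (G : graph n) (u t : 'I_n).

(** Both orientations of the edge are removed, so that connectivity stays symmetric and describes
    the two sides of the deleted edge. *)
Definition adj_del : rel 'I_n :=
  [rel a b | adj G a b && ((a, b) \notin [:: (u, t); (t, u)])].

Lemma connect_adj_del_sym : connect_sym adj_del.
Proof.
apply: sym_connect_sym => a b; rewrite /adj_del /= adj_sym !inE !xpair_eqE.
by congr (_ && ~~ _); rewrite orbC; congr (_ || _); rewrite andbC.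
Qed.

End DeleteEdge.

Section Forests.
Variables (n : nat) (G : graph n).
Hypothesis forestG : forest G.
Implicit Types (u v w t : 'I_n) (p q : seq 'I_n) (S : {set 'I_n}).

Lemma adj_neq u w : adj G u w -> u != w.
Proof. by apply: contraTneq => ->; rewrite adj_irr. Qed.

(** Otherwise the path up to [z], closed by the edge between [z] and [x], is a cycle with at least
    three vertices. *)
Lemma path_back x y p z : path (adj G) x (y :: p) -> uniq [:: x, y & p] ->
  adj G x z -> z != y -> z \notin p.
Proof.
move=> pp up xz zy; apply/negP => /splitPr zp; case: zp pp up => p1 p2.
move=> /= /andP[xy]; rewrite cat_path /= => /and3P[yp1 lz _].
rewrite inE mem_cat inE !negb_or cat_uniq /= !mem_cat !inE !negb_or.
case/and3P=> /and4P[xNy xNp1 xNz _] /and3P[yNp1 yNz _] /and3P[up1 /andP[zNp1 _] _].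
have := forestG (c := [:: x, y & rcons p1 z]); rewrite /= size_rcons => /(_ isT).
rewrite /ucycleb /= !rcons_path xy yp1 lz last_rcons adj_sym xz /=.
rewrite inE !mem_rcons !inE !negb_or rcons_uniq.
by rewrite xNy xNp1 xNz yNp1 yNz zNp1 up1.
Qed.

(** If every vertex of [S] had two neighbours in [S], a path could be prolonged at its front
    forever: by [path_back] it never meets itself, so it would outgrow the vertex set. *)
Lemma forest_leaf S : S != set0 ->
  exists2 v, v \in S & {in S &, forall a b, adj G v a -> adj G v b -> a = b}.
Proof.
move=> /set0Pn[v0 v0S]; apply: contrapT => noleaf.
have ext v : v \in S -> forall y, exists2 z, z \in S & adj G v z && (z != y).
  move=> vS y; apply: contrapT => noz; apply: noleaf; exists v => // a b aS bS va vb.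
  apply/eqP; apply: contraT => ab; case: noz.
  have [ay|ay] := eqVneq a y; last by exists a => //; rewrite va.
  by exists b => //; rewrite vb -ay eq_sym.
(* Such a path has [k + 2] distinct vertices, too many for [k = n]. *)
suff long k : exists x y p,
    [/\ path (adj G) x (y :: p), uniq [:: x, y & p], x \in S & size p = k].
  have [x [y [p [_ up _ sp]]]] := long n.
  by have := max_card (mem [:: x, y & p]); rewrite (card_uniqP up) card_ord /= sp ltnNge leqnSn.
elim: k => [|k [x [y [p [pp up xS sp]]]]].
  have [z zS /andP[v0z _]] := ext _ v0S v0.
  exists z, v0, [::]; split=> //=; first by rewrite adj_sym v0z.
  by rewrite inE eq_sym adj_neq.
have [z zS /andP[xz zy]] := ext _ xS y.
have zNp := path_back pp up xz zy.
exists z, x, (y :: p); split=> //; last by rewrite /= sp.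
  by rewrite /= adj_sym xz.
rewrite cons_uniq up andbT !inE !negb_or zy zNp eq_sym adj_neq //.
Qed.

(** Leaves are peeled off one at a time and put back in reverse order. *)
Lemma forest_ind (P : {set 'I_n} -> Prop) :
  P set0 ->
  (forall S v, v \notin S -> {in S &, forall a b, adj G v a -> adj G v b -> a = b} ->
     P S -> P (v |: S)) ->
  P setT.
Proof.
move=> P0 PS; move: {-1}#|_| (leqnn #|[set: 'I_n]|) => k; move: setT => S.
elim: k S => [|k IHk] S kS.
  by rewrite leqn0 cards_eq0 in kS; rewrite (eqP kS).
have [->//|/forest_leaf[v vS leafv]] := eqVneq S set0.
rewrite -(setD1K vS); apply: PS; first by rewrite setD11.
  by move=> a b /setD1P[_ aS] /setD1P[_ bS]; apply: leafv.
by apply: IHk; rewrite (cardsD1 v S) vS in kS.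
Qed.

(** By leaf induction: a new vertex takes the colour opposite to that of its only possible earlier
    neighbour. *)
Lemma forest_colouring : exists col : 'I_n -> bool,
  forall u w, adj G u w -> col u != col w.
Proof.
suff [col colP] : exists col : 'I_n -> bool,
    {in setT &, forall u w, adj G u w -> col u != col w}.
  by exists col => u w; apply: colP; rewrite inE.
elim/forest_ind: setT => [|S v vNS leafv [col colP]].
  by exists xpredT => u w; rewrite inE.
pose cv := if [pick a in S | adj G v a] is Some a then ~~ col a else true.
have cvP a : a \in S -> adj G v a -> cv != col a.
  move=> aS va; rewrite /cv; case: pickP => [b /andP[bS vb]|/(_ a)]; last by rewrite aS va.
  by rewrite (leafv a b) //; case: (col b).
have Sv x : x \in S -> (x == v) = false by move=> xS; apply: contraNF vNS => /eqP <-.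
exists (fun x => if x == v then cv else col x) => u w.
case/setU1P=> [->|uS]; case/setU1P=> [->|wS]; rewrite ?eqxx ?adj_irr //.
- by move=> vw; rewrite Sv ?cvP.
- by rewrite adj_sym => vu; rewrite Sv // eq_sym cvP.
- by move=> uw; rewrite !Sv ?colP.
Qed.

(** The pairs are ordered, so each vertex added in the leaf induction contributes at most two. *)
Lemma forest_card_edges : (#|[set e : 'I_n * 'I_n | adj G e.1 e.2]| <= 2 * n)%N.
Proof.
pose E S := [set e : 'I_n * 'I_n | [&& e.1 \in S, e.2 \in S & adj G e.1 e.2]].
suff ES : (#|E setT| <= 2 * #|[set: 'I_n]|)%N.
  rewrite cardsT card_ord in ES; apply: leq_trans ES; apply: subset_leq_card.
  by apply/subsetP=> e; rewrite !inE.
elim/forest_ind: setT => [|S v vNS leafv IHS].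
  by rewrite cards0 leqn0 cards_eq0 -subset0; apply/subsetP=> e; rewrite !inE.
pose a := odflt v [pick a in S | adj G v a].
have aP b : b \in S -> adj G v b -> b = a.
  move=> bS vb; rewrite /a; case: pickP => [c /andP[cS vc]|/(_ b)]; last by rewrite bS vb.
  exact: leafv.
have sub : E (v |: S) \subset E S :|: [set (v, a); (a, v)].
  apply/subsetP=> -[x y]; rewrite !inE /= !xpair_eqE.
  case: (eqVneq x v) => [->|xv]; case: (eqVneq y v) => [->|yv] /=; rewrite ?adj_irr ?andbF //.
  - by case/andP=> yS vy; rewrite (aP y) // eqxx !orbT.
  - by case/andP=> xS; rewrite adj_sym => vx; rewrite (aP x) // eqxx !orbT.
  - by move=> ->.
apply: leq_trans (subset_leq_card sub) _; rewrite cardsU1 vNS mulnDr addnC muln1.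
apply: leq_trans (leq_card_setU _ _) _; apply: leq_add => //.
by rewrite cards2; case: (_ != _).
Qed.

(** A simple path from [t] to [u] that avoids the edge has at least two edges, and [ut] closes it to
    a cycle. *)
Lemma forest_bridge u t : adj G u t ->
  ~~ connect (adj_del G u t) t u.
Proof.
move=> ut; apply/negP => /connectP[p0 pp0 lp0].
case: (shortenP pp0) lp0 => p pp up _ lu.
have pG : path (adj G) t p by apply: sub_path pp => a b /andP[].
have := forestG (c := t :: p).
case: p pp pG up lu => [|x [|y p]] /= pp pG up lu.
- by rewrite lu adj_irr in ut.
- by move: pp; rewrite -lu /adj_del /= !inE eqxx orbT !andbF.
- move=> /(_ isT); rewrite /ucycleb /= rcons_path -lu ut.
  by case/and3P: pG => -> -> ->; case/andP: up => -> /=; case/andP=> -> ->.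
Qed.

(** Where the paths first diverge, into [a] and [b], their remainders avoid [v] and so do not use
    the edge [va]. Going from [a] to [w], back to [b] and then to [v] bypasses this edge, which is a
    bridge. *)
Lemma simple_path_uniq v w p q :
  simple_path G v w p -> simple_path G v w q -> p = q.
Proof.
elim: p v q => [|a p IHp] v q.
  case/and3P=> _ /eqP/= <- _ /and3P[_ /eqP lq uq].
  by case: q lq uq => //= b q lq; rewrite -lq mem_last.
case: q => [|b q].
  case/and3P=> _ lw uw /and3P[_ /eqP/= vw _].
  by move: uw; rewrite -(eqP lw) /= in vw *; rewrite vw mem_last.
move=> /and3P[/= /andP[va pa] la /andP[vNp up]] /and3P[/= /andP[vb pb] lb /andP[vNq uq]].
suff ab : a = b.
  by subst b; congr cons; apply: (IHp a); rewrite /simple_path ?pa ?la ?up ?pb ?lb ?uq.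
apply/eqP; apply: contraT => ab; case/negP: (forest_bridge va).
set e := adj_del _ _ _; have es : connect_sym e := @connect_adj_del_sym _ _ _ _.
have avoid x s : v \notin x :: s -> path (adj G) x s -> connect e x (last x s).
  elim: s x => [|y s IHs] x; first by rewrite connect0.
  rewrite inE negb_or => /andP[vx vys] /= /andP[xy ps].
  apply: connect_trans (IHs y vys ps); apply: connect1.
  have vy : v != y by move: vys; rewrite inE negb_or => /andP[].
  by rewrite /e /adj_del /= xy !inE !xpair_eqE ![_ == v]eq_sym (negPf vx) (negPf vy) andbF.
have := avoid a p vNp pa; rewrite (eqP la) => aw.
have := avoid b q vNq pb; rewrite (eqP lb) => bw.
rewrite es in bw; apply: connect_trans aw (connect_trans bw (connect1 _)).
rewrite /e /adj_del /= adj_sym vb !inE !xpair_eqE (eq_sym b a) (negPf ab) (eq_sym b v).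
by rewrite (negPf (adj_neq vb)).
Qed.

Lemma connect_simple_path v w : connect (adj G) v w -> exists p, simple_path G v w p.
Proof.
move=> /connectP[p0 pp0 lp0]; case: (shortenP pp0) lp0 => p pp up _ ->.
by exists p; rewrite /simple_path pp eqxx.
Qed.

Lemma on_pathE v w p a b : simple_path G v w p ->
  on_path G v w a b = infix [:: a; b] (v :: p).
Proof.
move=> vwp; apply/asboolP/idP => [[q vwq]|]; last by exists p.
by rewrite (simple_path_uniq vwp vwq).
Qed.

End Forests.

(** * Diagonal scaling of null spaces *)

Section NullSpaces.
Variables (K : fieldType) (n : nat).
Implicit Types (M : 'M[K]_n) (G : graph n) (W : {vspace 'cV[K]_n}) (d : 'I_n -> K).

Lemma mem_Null M (x : 'cV[K]_n) : (x \in Null M) = (M *m x == 0).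
Proof. by rewrite memv_ker lfunE. Qed.

Lemma NullP M (x : 'cV[K]_n) :
  reflect (forall t, \sum_u M t u * x u 0 = 0) (x \in Null M).
Proof.
rewrite mem_Null; apply: (iffP eqP) => [Mx t|Mx].
  by have /matrixP/(_ t 0) := Mx; rewrite !mxE.
by apply/matrixP => t j; rewrite ord1 !mxE Mx.
Qed.

Lemma in_M0_neq0 G M u w : in_M0 G M -> (M u w != 0) = adj G u w.
Proof.
case=> M0 MG; have [<-|uw] := eqVneq u w; first by rewrite M0 eqxx adj_irr.
by apply/idP/idP => /MG; apply.
Qed.

Lemma in_M0_eq0 G M u w : in_M0 G M -> ~~ adj G u w -> M u w = 0.
Proof. by move=> MG; rewrite -(in_M0_neq0 _ _ MG) negbK => /eqP. Qed.

Lemma adjmx_in_M0 G : in_M0 G (adjmx K G).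
Proof.
split=> [u|u w _]; rewrite mxE ?adj_irr //.
by case: (adj G u w); rewrite ?oner_eq0 ?eqxx.
Qed.

Definition scale d (x : 'cV[K]_n) : 'cV[K]_n := diag_mx (\row_i d i) *m x.

Lemma scaleE d x i j : scale d x i j = d i * x i j.
Proof. by rewrite /scale mul_diag_mx !mxE. Qed.

Lemma scaleK d : (forall i, d i != 0) -> cancel (scale d) (scale (fun i => (d i)^-1)).
Proof. by move=> d0 x; apply/matrixP=> i j; rewrite !scaleE mulKf. Qed.

Lemma scaleVK d : (forall i, d i != 0) -> cancel (scale (fun i => (d i)^-1)) (scale d).
Proof. by move=> d0 x; apply/matrixP=> i j; rewrite !scaleE mulVKf. Qed.

Lemma invmx_diag d : (forall i, d i != 0) ->
  invmx (diag_mx (\row_i d i)) = diag_mx (\row_i (d i)^-1).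
Proof.
move=> d0; have D : diag_mx (\row_i d i) *m diag_mx (\row_i (d i)^-1) = 1%:M.
  apply/matrixP=> i j; rewrite mul_diag_mx !mxE.
  by case: eqVneq => [->|_]; rewrite ?mulr0 // mulr1n mulfV.
by have [u _] := mulmx1_unit D; rewrite -[RHS](mulKmx u) D mulmx1.
Qed.

(** Scaling is linear and injective, and the two inclusions make [W'] the image of [W]. *)
Lemma basis_of_scale d W W' B : (forall i, d i != 0) ->
  {in W, forall x, scale d x \in W'} ->
  {in W', forall x, scale (fun i => (d i)^-1) x \in W} ->
  basis_of W B -> basis_of W' (map (scale d) B).
Proof.
move=> d0 WW' W'W BB; pose f := linfun (mulmx (diag_mx (\row_i d i)) : 'cV[K]_n -> _).
have fE x : f x = scale d x by rewrite lfunE.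
have f0 : lker f == 0%VS by apply/lker0P => x y; rewrite !fE => /(can_inj (scaleK d0)).
have -> : W' = (f @: W)%VS.
  apply/vspaceP=> x; apply/idP/memv_imgP => [xW'|[y yW ->]]; last by rewrite fE WW'.
  by exists (scale (fun i => (d i)^-1) x); rewrite ?W'W // fE scaleVK.
rewrite -(eq_map fE) limg_basis_of //.
by rewrite (eqP f0) capv0.
Qed.

Lemma nnz_scale d B : (forall i, d i != 0) -> nnz (map (scale d) B) = nnz B.
Proof.
move=> d0; rewrite /nnz big_map; apply: eq_bigr => b _; apply: eq_card => i.
by rewrite !inE scaleE mulf_eq0 (negPf (d0 i)).
Qed.

(** A competing basis of [W'] is pulled back to [W] by the inverse scaling, which keeps the number
    of nonzero entries. *)
Lemma sparsest_basis_scale d W W' B : (forall i, d i != 0) ->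
  {in W, forall x, scale d x \in W'} ->
  {in W', forall x, scale (fun i => (d i)^-1) x \in W} ->
  sparsest_basis W B -> sparsest_basis W' (map (scale d) B).
Proof.
move=> d0 WW' W'W [BB minB]; split; first exact: basis_of_scale BB.
move=> B' BB'; rewrite nnz_scale //; have d0' i : (d i)^-1 != 0 by rewrite invr_eq0.
rewrite -(nnz_scale B' d0'); apply/minB/(basis_of_scale d0' W'W) => // x xW.
suff -> : scale (fun i => (d i)^-1^-1) x = scale d x by apply: WW'.
by apply/matrixP=> i j; rewrite !scaleE invrK.
Qed.

(** Leaf induction: the new vertex [v] has at most one earlier neighbour [a], so [rv] is constrained
    only by [M v a] and [cv] only by [M a v]. *)
Lemma forest_scaling G M : forest G -> in_M0 G M ->
  exists r c : 'I_n -> K, [/\ forall i, r i != 0, forall i, c i != 0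
    & forall u w, adj G u w -> M u w = r u * c w].
Proof.
move=> forG MG.
suff [r [c [r0 c0 rcP]]] : exists r c : 'I_n -> K, [/\ forall i, r i != 0, forall i, c i != 0
    & {in setT &, forall u w, adj G u w -> M u w = r u * c w}].
  by exists r, c; split=> // u w; apply: rcP; rewrite inE.
elim/(forest_ind forG): setT => [|S v vNS leafv [r [c [r0 c0 rcP]]]].
  by exists (fun=> 1), (fun=> 1); split=> [i|i|u w]; rewrite ?oner_eq0 ?inE.
have [rv [cv [rv0 cv0 rcv]]] : exists rv cv, [/\ rv != 0, cv != 0 &
    {in S, forall a, adj G v a -> M v a = rv * c a /\ M a v = r a * cv}].
  have [a /andP[aS va]|noa] := pickP (fun a => (a \in S) && adj G v a); last first.
    by exists 1, 1; split=> [||a aS va]; rewrite ?oner_eq0 //; move: (noa a); rewrite aS va.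
  exists (M v a / c a), (M a v / r a).
  rewrite !mulf_neq0 ?invr_eq0 ?(in_M0_neq0 _ _ MG) // 1?adj_sym //; split=> // b bS vb.
  by rewrite (leafv b a) // divfK // mulrC divfK.
have Sv x : x \in S -> (x == v) = false by move=> xS; apply: contraNF vNS => /eqP <-.
exists (fun x => if x == v then rv else r x), (fun x => if x == v then cv else c x).
split=> [i|i|u w]; [by case: ifP|by case: ifP|].
case/setU1P=> [->|uS]; case/setU1P=> [->|wS]; rewrite ?eqxx ?adj_irr //.
- by move=> vw; rewrite Sv //; have [] := rcv w wS vw.
- by rewrite adj_sym => vu; rewrite Sv //; have [] := rcv u uS vu.
- by move=> uw; rewrite !Sv ?rcP.
Qed.

(** The equation of [M] in row [t] is [r t] times that of the adjacency matrix, evaluated at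
    [scale c x]. *)
Lemma Null_scaling G M (r c : 'I_n -> K) : in_M0 G M ->
  (forall i, r i != 0) ->
  (forall u w, adj G u w -> M u w = r u * c w) ->
  forall x, (scale c x \in Null (adjmx K G)) = (x \in Null M).
Proof.
move=> MG r0 rcP x.
have sumE t : \sum_u M t u * x u 0 = r t * \sum_u adjmx K G t u * scale c x u 0.
  rewrite big_distrr; apply: eq_bigr => u _; rewrite scaleE mxE /=.
  have [tu|tu] := boolP (adj G t u); first by rewrite rcP // mul1r mulrA.
  by rewrite (in_M0_eq0 MG) // !mul0r mulr0.
apply/NullP/NullP => H t; first by rewrite sumE H mulr0.
by apply: (mulfI (r0 t)); rewrite -sumE H mulr0.
Qed.

Lemma Supp_adjmx G M : forest G -> in_M0 G M -> Supp M = Supp (adjmx K G).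
Proof.
move=> forG MG; have [r [c [r0 c0 rcP]]] := forest_scaling forG MG.
have NE := Null_scaling MG r0 rcP.
apply/setP=> w; rewrite !inE; apply/asboolP/asboolP => -[x xN xw].
  by exists (scale c x); rewrite ?NE // scaleE mulf_neq0.
exists (scale (fun i => (c i)^-1) x); first by rewrite -NE scaleVK.
by rewrite scaleE mulf_neq0 ?invr_eq0.
Qed.

(* Summing y * (A x) - x * (A y) over the side of t of the bridge ut leaves only
   the boundary terms of the bridge. *)
Lemma Null_wronskian G u t (x y : 'cV[K]_n) : forest G -> adj G u t ->
  x \in Null (adjmx K G) -> y \in Null (adjmx K G) ->
  y t 0 * x u 0 = x t 0 * y u 0.
Proof.
move=> forG ut /NullP Nx /NullP Ny.
pose e := adj_del G u t; have es : connect_sym e := @connect_adj_del_sym _ _ _ _.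
pose S := [set a | connect e t a].
have tS : t \in S by rewrite inE connect0.
have uNS : u \notin S by rewrite inE forest_bridge.
(* The bridge is the only edge that leaves [S]. *)
have out a b : a \in S -> b \notin S -> adj G a b -> (a, b) = (t, u).
  rewrite !inE => ta tb ab; apply/eqP; apply: contraR tb => abtu.
  apply: (connect_trans ta); apply: connect1; rewrite /e /adj_del /= ab !inE (negPf abtu) orbF.
  by apply/eqP => -[au _]; rewrite -au inE ta in uNS.
pose A := adjmx K G; pose h a b := A a b * (y a 0 * x b 0) - A a b * (x a 0 * y b 0).
have inner : \sum_(a in S) \sum_(b in S) h a b = 0.
  under eq_bigr => a _ do rewrite sumrB.
  rewrite sumrB [X in _ - X]exchange_big /=; apply/eqP; rewrite subr_eq0; apply/eqP.
  apply: eq_bigr => a _; apply: eq_bigr => b _.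
  by rewrite !mxE adj_sym [x b 0 * _]mulrC.
have outer : \sum_(a in S) \sum_(b | b \notin S) h a b = h t u.
  have h0 a b : a \in S -> b \notin S -> (a, b) != (t, u) -> h a b = 0.
    move=> aS bS abtu; suff ab : ~~ adj G a b by rewrite /h !mxE (negPf ab) !mul0r subrr.
    by apply: contra abtu => ab; rewrite (out a b).
  rewrite (bigD1 t) //= (bigD1 u) //= !big1 ?addr0 // => [a /andP[aS at_]|b /andP[bS bu]].
    by rewrite big1 // => b bS; rewrite h0 // xpair_eqE (negPf at_).
  by rewrite h0 // xpair_eqE (negPf bu) andbF.
(* Summed over all [b], each row vanishes because [x] and [y] are null vectors. *)
have total : \sum_(a in S) \sum_b h a b = 0.
  rewrite big1 // => a _; rewrite sumrB.
  under eq_bigr => b _ do rewrite mulrCA.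
  under [X in _ - X]eq_bigr => b _ do rewrite mulrCA.
  by rewrite -!big_distrr /= Nx Ny !mulr0 subrr.
move: total; under eq_bigr => a _ do rewrite (bigID (mem S)) /=.
rewrite big_split /= inner outer add0r /h !mxE adj_sym ut !mul1r => /eqP.
by rewrite subr_eq0 => /eqP.
Qed.

End NullSpaces.

(** * The matrix D^(M,U) *)

Section PathWeights.
Variables (K : fieldType) (n : nat) (G : graph n).
Hypothesis forestG : forest G.
Implicit Types (M : 'M[K]_n).

(** Let null vectors [x] and [y] be nonzero at [u] and [t] respectively. Cutting [y] down to the
    colour of [t] kills its value at [u], and the Wronskian identity leaves a product of two nonzero
    factors equal to zero. *)
Lemma Supp_independent u t : adj G u t ->
  u \in Supp (adjmx K G) -> t \notin Supp (adjmx K G).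
Proof.
move=> ut; rewrite !inE => /asboolP[x xN xu]; apply/asboolP => -[y yN yt].
have [col colP] := forest_colouring forestG.
(* The adjacency matrix exchanges the two colours, so that y may be assumed to
   vanish off the colour of t. *)
pose z : 'cV[K]_n := \col_i (y i 0 *+ (col i == col t)).
have zN : z \in Null (adjmx K G).
  apply/NullP => s; have /NullP/(_ s) := yN.
  have [st|st] := eqVneq (col s) (col t).
    move=> _; rewrite big1 // => w _; rewrite !mxE.
    have [sw|_] := boolP (adj G s w); last by rewrite mul0r.
    by have /negPf := colP _ _ sw; rewrite st eq_sym => ->; rewrite mulr0.
  move=> sum0; rewrite -[RHS]sum0; apply: eq_bigr => w _; rewrite !mxE.
  have [sw|_] := boolP (adj G s w); last by rewrite !mul0r.
  have -> : col w == col t by move: (colP _ _ sw) st; case: (col s) (col t) (col w) => [] [] [].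
  by rewrite mulr1n.
have /eqP := Null_wronskian forestG ut xN zN.
have /negPf ut_col := colP _ _ ut.
by rewrite !mxE eqxx ut_col mulr0 mulf_eq0 (negPf xu) (negPf yt).
Qed.

(** Meant for products over the arcs of a path to which one arc [e] is appended; [B] decides whether
    [e] yields a factor. *)
Lemma prod_arc_rcons (T : finType) (B P Q : pred T) (e : T) (f : T -> K) :
  ~~ P e -> (forall x, Q x = P x || (x == e)) ->
  \prod_(x | B x && Q x) f x = (\prod_(x | B x && P x) f x) * (if B e then f e else 1).
Proof.
move=> Pe QE; case: ifP => Be; last first.
  rewrite mulr1; apply: eq_bigl => x; rewrite QE; case: eqVneq => [->|_]; rewrite ?orbF //.
  by rewrite Be.
rewrite (bigD1 e) /=; last by rewrite Be QE eqxx orbT.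
rewrite mulrC; congr (_ * _); apply: eq_bigl => x; rewrite QE.
by case: eqVneq => [->|_]; rewrite ?(negPf Pe) ?andbF //= orbF andbT.
Qed.

Lemma simple_path_rcons v w w' p : simple_path G v w p -> adj G w w' ->
  w' \notin v :: p -> simple_path G v w' (rcons p w').
Proof.
case/and3P=> pp /eqP lp up ww' w'p; rewrite /simple_path rcons_path pp lp ww'.
by rewrite last_rcons eqxx -rcons_cons rcons_uniq w'p.
Qed.

Lemma Dcoef_rcons M v w w' p : simple_path G v w p -> adj G w w' -> w' \notin v :: p ->
  Dcoef M G v w' = Dcoef M G v w * ((if w \in Supp M then (M w' w)^-1 else 1)
                                    * (if w' \in Supp M then M w w' else 1)).
Proof.
move=> vp ww' w'p; have vp' := simple_path_rcons vp ww' w'p.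
have on a b : on_path G v w' a b = on_path G v w a b || ((a == w) && (b == w')).
  rewrite (on_pathE _ _ _ vp') // (on_pathE _ _ _ vp) // -rcons_cons infix_rconsl orbC.
  congr (_ || _); case/and3P: vp => _ /eqP <- _.
  by rewrite (lastI v p) /suffix !rev_rcons /= prefix0s andbT andbC.
have off a : ~~ on_path G v w a w'.
  rewrite (on_pathE _ _ _ vp) //; apply: contra w'p => /infixP[s1 [s2 ->]].
  by rewrite !mem_cat !inE eqxx !orbT.
have off' a : ~~ on_path G v w w' a.
  rewrite (on_pathE _ _ _ vp) //; apply: contra w'p => /infixP[s1 [s2 ->]].
  by rewrite !mem_cat !inE eqxx !orbT.
(* As products over pairs, both run over arcs, and each gains at most the new one. *)
rewrite /Dcoef !pair_big_dep /=.
rewrite (@prod_arc_rcons _ (fun e => e.1 \in Supp M) (fun e => on_path G v w e.1 e.2)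
           (fun e => on_path G v w' e.1 e.2) (w, w') (fun e => (M e.2 e.1)^-1)) //=.
rewrite (@prod_arc_rcons _ (fun e => e.1 \in Supp M) (fun e => on_path G v w e.2 e.1)
           (fun e => on_path G v w' e.2 e.1) (w', w) (fun e => M e.2 e.1)) //=.
  by rewrite mulrACA.
by move=> [a b]; rewrite on /= xpair_eqE andbC.
Qed.

Lemma Dcoef_disconnected M v w : ~~ connect (adj G) v w -> Dcoef M G v w = 1.
Proof.
move=> vw; have off a b : on_path G v w a b = false.
  apply/negbTE; apply: contra vw => /asboolP[p /and3P[pp /eqP <- _] _].
  by apply/connectP; exists p.
by rewrite /Dcoef !big1 ?mulr1 // => u _; rewrite big_pred0 // => t; rewrite off.
Qed.

Lemma Dcoef_neq0 M v w : in_M0 G M -> Dcoef M G v w != 0.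
Proof.
move=> MG; rewrite /Dcoef mulf_neq0 //; apply/prodf_neq0 => u _; apply/prodf_neq0 => t.
  by move/on_path_adj => ut; rewrite invr_eq0 (in_M0_neq0 _ _ MG) adj_sym.
by move/on_path_adj => ut; rewrite (in_M0_neq0 _ _ MG).
Qed.

(** Either the path from [v] continues from [t] to [u], gaining [M t u], or it reaches [t] through
    [u], gaining the inverse of [M t u]. The arc gives no further factor since [t] is outside the
    support. *)
Lemma Dcoef_Supp M v t u : in_M0 G M -> adj G t u -> u \in Supp M -> t \notin Supp M ->
  connect (adj G) v t -> Dcoef M G v u = Dcoef M G v t * M t u.
Proof.
move=> MG tu uS tS vt; have [p vp] := connect_simple_path vt.
have [up|up] := boolP (u \in v :: p); last first.
  by rewrite (Dcoef_rcons _ vp tu up) (negPf tS) uS mul1r.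
have ut : adj G u t by rewrite adj_sym.
(* The path to [t] is cut after [u]; its last vertex [t] falls into the part cut off. *)
have [q [vq tq]] : exists q, simple_path G v u q /\ t \notin v :: q.
  have vt' : t != v.
    apply/eqP => tv; case/and3P: vp up => _; rewrite tv.
    case: p => [|a p] /= => [_ _|/eqP<- /andP[/negP[]]]; last exact: mem_last.
    by rewrite inE => /eqP uv; move: tu; rewrite tv uv adj_irr.
  move: up; rewrite inE; case: eqVneq => [-> _|uv /= up].
    by exists [::]; rewrite /simple_path /= eqxx !inE.
  case: (path.splitP up) vp => q1 q2 /and3P[]; rewrite cat_path last_cat last_rcons => /andP[pq1 _] lq2.
  rewrite -cat_cons cat_uniq -rcons_cons => /and3P[uq1 hq _].
  exists (rcons q1 u); split; first by rewrite /simple_path pq1 last_rcons eqxx -rcons_cons.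
  case: q2 lq2 hq => [|b q2] lq2 hq; first by move: tu; rewrite -(eqP lq2) adj_irr.
  by apply: contra hq => tq; apply/hasP; exists t; rewrite // -(eqP lq2) /= mem_last.
rewrite (Dcoef_rcons _ vq ut tq) uS (negPf tS) mulr1 divfK //.
by rewrite (in_M0_neq0 _ _ MG).
Qed.

(** A null vector restricted to a component remains a null vector there, as no edge leaves the
    component. This guarantees a root in every component that meets the support. *)
Lemma Supp_adj_component M v : in_M0 G M -> v \in Supp M ->
  Supp_adj K G [set w | connect (adj G) v w] != set0.
Proof.
move=> MG; rewrite (Supp_adjmx forestG MG) inE => /asboolP[x /NullP xN xv].
set T := [set w | _]; have vT : v \in T by rewrite inE connect0.
apply/set0Pn; exists v; apply/imsetP; exists (enum_rank_in vT v); last by rewrite enum_rankK_in.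
rewrite inE; apply/asboolP; exists (\col_i x (enum_val i) 0); last first.
  by rewrite mxE enum_rankK_in.
apply/NullP => i; rewrite -[RHS](xN (enum_val i)) [RHS](bigID (mem T)) /=.
rewrite [X in _ = _ + X]big1 => [|w wT].
  by rewrite addr0 [RHS]big_enum_val; apply: eq_bigr => j _; rewrite !mxE.
rewrite mxE; suff /negPf -> : ~~ adj G (enum_val i) w by rewrite mul0r.
have := enum_valP i; rewrite !inE in wT * => vi.
by apply: contra wT => iw; apply: connect_trans vi (connect1 iw).
Qed.

Section Roots.
Variables (M : 'M[K]_n) (U : {set 'I_n}).
Hypotheses (MG : in_M0 G M) (UP : choice_of_roots K G U).

Let D w := \prod_(v in U) Dcoef M G v w.

Lemma Dset_diag : Dset M G U = diag_mx (\row_w D w).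
Proof.
congr diag_mx; apply/rowP=> w; rewrite !mxE; apply: eq_bigr => v _.
by rewrite !mxE eqxx mulr1n.
Qed.

(** Exactly one root lies in the component of [t] and [u], where [Dcoef_Supp] applies; the others
    contribute the factor 1 on both sides. *)
Lemma Dset_Supp t u : adj G t u -> u \in Supp M -> t \notin Supp M ->
  D u = D t * M t u.
Proof.
move=> tu uS tS; have cs : connect_sym (adj G) := sym_connect_sym (adj_sym G).
pose T := [set w | connect (adj G) u w].
have TG : T \in components G.
  apply/imsetP; exists u; rewrite ?inE //.
  by apply/setP=> w; rewrite !inE.
have := UP TG; rewrite (negPf (Supp_adj_component MG uS)) => -[v _ UT].
have [vU vT] : v \in U /\ v \in T by apply/andP; rewrite -in_setI UT set11.
have vu : connect (adj G) v u by rewrite cs; rewrite inE in vT.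
have vt : connect (adj G) v t by apply: connect_trans vu (connect1 _); rewrite adj_sym.
rewrite /D (bigD1 v) //= [in RHS](bigD1 v) //= (Dcoef_Supp MG tu uS tS vt).
rewrite mulrAC; congr (_ * _ * _).
rewrite !big1 // => v' /andP[v'U v'v]; apply: Dcoef_disconnected.
  apply: contra v'v => v't; rewrite -in_set1 -UT in_setI v'U inE cs.
  by apply: connect_trans v't (connect1 tu).
by apply: contra v'v => v'u; rewrite -in_set1 -UT in_setI v'U inE cs.
Qed.

Let D0 w : D w != 0.
Proof. by apply/prodf_neq0 => v _; apply: Dcoef_neq0. Qed.

(* Every equation of the system M y = 0 outside the support becomes, after the
   substitution y = D^-1 x, a multiple of the one of A x = 0; those in the support
   are trivial because the support is independent. *)
Lemma Null_Dset x : (scale D x \in Null (adjmx K G)) = (x \in Null M).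
Proof.
have supM y : y \in Null M -> forall u, y u 0 != 0 -> u \in Supp M.
  by move=> yN u yu; rewrite inE; apply/asboolP; exists y.
have supA y : scale D y \in Null (adjmx K G) -> forall u, y u 0 != 0 -> u \in Supp M.
  move=> yN u yu; rewrite (Supp_adjmx forestG MG) inE; apply/asboolP.
  by exists (scale D y); rewrite ?scaleE ?mulf_neq0.
have indep t u : adj G t u -> t \in Supp M -> u \notin Supp M.
  by rewrite (Supp_adjmx forestG MG); apply: Supp_independent.
have eqs : (forall u, x u 0 != 0 -> u \in Supp M) -> forall t,
    \sum_u adjmx K G t u * scale D x u 0 = D t * \sum_u M t u * x u 0.
  move=> supx t; rewrite big_distrr; apply: eq_bigr => u _; rewrite scaleE mxE /=.
  have [tu|tu] := boolP (adj G t u); last by rewrite (in_M0_eq0 MG) // !mul0r mulr0.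
  have [->|/supx uS] := eqVneq (x u 0) 0; first by rewrite !mulr0.
  have tS : t \notin Supp M by apply: indep uS; rewrite adj_sym.
  by rewrite mul1r (Dset_Supp tu uS tS) mulrA.
apply/idP/idP => xN.
  apply/NullP => t; apply: (mulfI (D0 t)); rewrite mulr0 -eqs; last exact: supA.
  by have /NullP := xN; apply.
apply/NullP => t; rewrite eqs; last exact: supM.
by have /NullP -> := xN; rewrite mulr0.
Qed.

Lemma sparsest_basis_Dset BF : sparsest_basis (Null (adjmx K G)) BF ->
  sparsest_basis (Null M) [seq invmx (Dset M G U) *m b | b <- BF].
Proof.
rewrite Dset_diag invmx_diag //; have D0' w : (D w)^-1 != 0 by rewrite invr_eq0.
apply: sparsest_basis_scale => // x xN; first by rewrite -Null_Dset scaleVK.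
have -> : scale (fun w => (D w)^-1^-1) x = scale D x.
  by apply/matrixP => i j; rewrite !scaleE invrK.
by rewrite Null_Dset.
Qed.

End Roots.

End PathWeights.

(** * Compressed sparse rows *)

Lemma count_disjointU (T : eqType) (a b : pred T) (s : seq T) :
  (forall x, a x -> ~~ b x) ->
  count (fun x => a x || b x) s = (count a s + count b s)%N.
Proof.
move=> ab; rewrite -count_predUI [X in (_ + X)%N](@eq_count _ _ pred0) ?count_pred0 ?addn0 //.
by move=> x /=; apply/negbTE/negP => /andP[/ab/negP].
Qed.

Lemma ltn_count (T : eqType) (a b : pred T) (s : seq T) x :
  {subset a <= b} -> x \in s -> b x -> ~~ a x -> (count a s < count b s)%N.
Proof.
move=> ab xs bx ax; rewrite (@eq_count _ b (fun y => a y || b y && ~~ a y)) => [|y].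
  rewrite count_disjointU => [|y ->]; last by rewrite andbF.
  by rewrite -ltn_subLR ?leqnn // subnn -has_count; apply/hasP; exists x; rewrite ?bx.
by case ay: (a y) => /=; rewrite ?andbT //; apply: (ab y).
Qed.

Section SortedCounting.
Variables (T : eqType) (r : rel T).
Hypotheses (r_irr : irreflexive r) (r_asym : forall x y, r x y -> ~~ r y x).

(** In a sorted list, the elements in front of [x] are those below [x]. *)
Lemma count_take_index (s : seq T) (a : pred T) x : pairwise r s -> x \in s ->
  count a (take (index x s) s) = count (fun y => a y && r y x) s.
Proof.
elim: s => //= y s IHs /andP[/allP ys ps]; rewrite inE eq_sym.
case: eqVneq => [yx|xy] /= xs.
  subst y; rewrite r_irr andbF add0n; apply/esym/eqP; rewrite -leqn0 leqNgt -has_count.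
  by apply/hasPn => z /ys/r_asym/negPf ->; rewrite andbF.
by rewrite (IHs ps xs) (ys x xs) andbT.
Qed.

Lemma index_pairwise (s : seq T) x : pairwise r s -> x \in s ->
  index x s = count (r^~ x) s.
Proof.
move=> ps xs; rewrite -(@count_take_index s xpredT) // count_predT size_take.
by rewrite index_mem xs.
Qed.

End SortedCounting.

Section NonzeroPositions.
Variables (K : fieldType) (n : nat) (M : 'M[K]_n).
Implicit Types (p q : 'I_n * 'I_n) (u w x : 'I_n).

Let nz := nz_pos M.

Definition lex : rel ('I_n * 'I_n) :=
  fun p q => (p.1 < q.1)%N || (p.1 == q.1) && (p.2 < q.2)%N.

Lemma lex_irr : irreflexive lex.
Proof. by move=> p; rewrite /lex !ltnn andbF. Qed.

Lemma lex_asym p q : lex p q -> ~~ lex q p.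
Proof.
rewrite /lex negb_or negb_and; case/orP=> [pq|/andP[/eqP-> pq]].
  by rewrite -leqNgt (ltnW pq) -(inj_eq val_inj) neq_ltn pq orbT.
by rewrite ltnn eqxx -leqNgt ltnW.
Qed.

Lemma mem_nz_pos p : (p \in nz) = (M p.1 p.2 != 0).
Proof.
rewrite mem_filter andb_idr // => _; apply/allpairsP; exists p.
by rewrite !mem_enum; case: p.
Qed.

Lemma nz_pos_lex : pairwise lex nz.
Proof.
apply: subseq_pairwise (filter_subseq _ _) _.
have : pairwise (fun i j : 'I_n => i < j)%N (enum 'I_n).
  have := iota_ltn_sorted 0 n; rewrite sorted_pairwise; last exact: ltn_trans.
  by rewrite -val_enum_ord pairwise_map.
move: (enum 'I_n) => s2 ps2.
suff gen s : pairwise (fun i j : 'I_n => i < j)%N s -> pairwise lex [seq (i, j) | i <- s, j <- s2].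
  exact: gen.
elim: s => //= i s IHs /andP[/allP is_ ps]; rewrite pairwise_cat IHs // andbT; apply/andP; split.
  apply/allrelP => p q /mapP[j _ ->] /allpairsP[[i' j'] /= [i's _ ->]].
  by rewrite /lex /= is_.
rewrite pairwise_map; apply: sub_pairwise ps2 => j j' /= jj'.
by rewrite /lex /= eqxx jj' orbT.
Qed.

Lemma nz_pos_uniq : uniq nz.
Proof.
rewrite filter_uniq // allpairs_uniq ?enum_uniq // => p q _ _.
by case: p q => [? ?] [? ?].
Qed.

Definition row_offset i := count (fun p => (p.1 < i)%N) nz.

Lemma row_offset_le i j : (i <= j)%N -> (row_offset i <= row_offset j)%N.
Proof. by move=> ij; apply: sub_count => p /= /leq_trans; apply. Qed.

Lemma row_offset_max : row_offset n = size nz.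
Proof. by rewrite -count_predT; apply: eq_count => p /=; rewrite ltn_ord. Qed.

Lemma row_offsetS w : row_offset w.+1 = (row_offset w + count (fun p => p.1 == w) nz)%N.
Proof.
rewrite /row_offset -count_disjointU => [|p]; last by move=> /ltn_eqF; rewrite -val_eqE /= => ->.
by apply: eq_count => p /=; rewrite ltnS leq_eqVlt orbC.
Qed.

Lemma index_nz_pos p : p \in nz ->
  index p nz = (row_offset p.1 + count (fun q => (q.1 == p.1) && (q.2 < p.2)%N) nz)%N.
Proof.
move=> pnz; rewrite (index_pairwise lex_irr lex_asym nz_pos_lex pnz).
rewrite /row_offset -count_disjointU // => q /ltn_eqF.
by rewrite -val_eqE /= => ->.
Qed.

Lemma index_nz_pos_row p : p \in nz ->
  (row_offset p.1 <= index p nz < row_offset p.1.+1)%N.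
Proof.
move=> pnz; rewrite index_nz_pos // leq_addr row_offsetS ltn_add2l /=.
apply: (ltn_count (x := p)) => //=; last by rewrite eqxx ltnn.
by move=> q /andP[].
Qed.

(** The index intervals of different rows are disjoint, so an index determines its row. *)
Lemma nth_nz_pos_row w p0 e : (row_offset w <= e < row_offset w.+1)%N ->
  (e < size nz)%N /\ (nth p0 nz e).1 = w.
Proof.
move=> /andP[le_e lt_e].
have e_lt : (e < size nz)%N.
  by apply: leq_trans lt_e _; rewrite -row_offset_max row_offset_le.
split=> //; have := index_nz_pos_row (mem_nth p0 e_lt).
rewrite index_uniq ?nz_pos_uniq // => /andP[le_e' lt_e'].
move: (nth p0 nz e).1 le_e' lt_e' => w' le_e' lt_e'.
apply: ord_inj; case: (ltngtP w' w) => // h.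
  by have := leq_trans lt_e' (leq_trans (row_offset_le h) le_e); rewrite ltnn.
by have := leq_trans lt_e (leq_trans (row_offset_le h) le_e'); rewrite ltnn.
Qed.

(** A row-major sweep meets the entries of a column in the order of their rows. The number met
    before [p] is therefore the rank of the mirrored entry in its own row. *)
Lemma row_offset_transpose p : (forall u w, (M u w != 0) = (M w u != 0)) -> p \in nz ->
  (row_offset p.2 + count (fun q => q.2 == p.2) (take (index p nz) nz))%N
  = index (p.2, p.1) nz.
Proof.
move=> Msym pnz; have pnz' : (p.2, p.1) \in nz by rewrite mem_nz_pos /= Msym -mem_nz_pos.
rewrite (count_take_index lex_irr lex_asym _ nz_pos_lex pnz) index_nz_pos //=; congr addn.
pose swap q : 'I_n * 'I_n := (q.2, q.1).
have swapI : injective swap by move=> [a b] [a' b'] [-> ->].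
have nz_swap : perm_eq nz (map swap nz).
  apply: uniq_perm; rewrite ?map_inj_uniq ?nz_pos_uniq // => q; rewrite mem_nz_pos Msym.
  by have -> : q = swap (swap q) by [case: q]; rewrite (mem_map swapI) mem_nz_pos.
rewrite [RHS](permP nz_swap) count_map; apply: eq_count => -[a b] /=.
by rewrite /lex /=; case: eqVneq => [->|//]; rewrite ltnn andbF orbF.
Qed.

End NonzeroPositions.

(** Hence the encodings of [M] and of the adjacency matrix differ only in the array of values. *)
Lemma in_M0_nz_pos (K : fieldType) n (G : graph n) (M : 'M[K]_n) : in_M0 G M ->
  nz_pos (adjmx K G) = nz_pos M.
Proof.
move=> MG; apply: eq_filter => p.
by rewrite (in_M0_neq0 _ _ MG) (in_M0_neq0 _ _ (adjmx_in_M0 K G)).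
Qed.

Lemma forest_size_nz_pos (K : fieldType) n (G : graph n) (M : 'M[K]_n) :
  forest G -> in_M0 G M -> (size (nz_pos M) <= 2 * n)%N.
Proof.
move=> forG MG; apply: leq_trans (forest_card_edges forG).
rewrite cardE; apply: uniq_leq_size; first exact: nz_pos_uniq.
by move=> p; rewrite mem_nz_pos mem_enum inE (in_M0_neq0 _ _ MG).
Qed.

(** * Execution of programs *)

Section Programs.
Variable K : fieldType.
Implicit Types (s : store K) (c : cmd) (b : test).

Fixpoint loopfree c : bool :=
  match c with
  | Skip | NSet _ _ _ | FSet _ _ _ => true
  | Seq c1 c2 | If _ c1 c2 => loopfree c1 && loopfree c2
  | While _ _ => false
  end.

Fixpoint csize c : nat :=
  match c with
  | Skip | NSet _ _ _ | FSet _ _ _ => 1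
  | Seq c1 c2 | If _ c1 c2 => (csize c1 + csize c2).+1
  | While _ c => (csize c).+1
  end.

(** A functional semantics for loop-free commands; the value at [While] is a dummy. *)
Fixpoint run c s : store K :=
  match c with
  | Skip | While _ _ => s
  | NSet a i e => Store (upd (nats s) a (neval s i) (neval s e)) (scals s)
  | FSet a i e => Store (nats s) (upd (scals s) a (neval s i) (feval s e))
  | Seq c1 c2 => run c2 (run c1 s)
  | If b c1 c2 => if teval s b then run c1 s else run c2 s
  end.

Lemma exec_run c s : loopfree c -> exists2 t, exec c s t (run c s) & (t <= csize c)%N.
Proof.
elim: c s => [|a i e|a i e|c1 IH1 c2 IH2|b c1 IH1 c2 IH2|b c _] s //=.
- by exists 1; first exact: exec_Skip.
- by exists 1; first exact: exec_NSet.
- by exists 1; first exact: exec_FSet.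
- case/andP=> /(IH1 s)[t1 e1 le1] /(IH2 (run c1 s))[t2 e2 le2].
  by exists (t1 + t2)%N; [exact: exec_Seq e1 e2 | lia].
- case/andP=> /(IH1 s)[t1 e1 le1] /(IH2 s)[t2 e2 le2].
  have [bs|bs] := boolP (teval s b).
    by exists t1.+1; [exact: exec_If_true | lia].
  by exists t2.+1; [exact: exec_If_false | lia].
Qed.

(** The index [k] of the invariant is a potential that drops in every round; the final 1 pays for
    the failing test. *)
Lemma exec_while (I : nat -> store K -> Prop) b c : loopfree c ->
  (forall k s, I k s -> teval s b -> exists2 k', (k' < k)%N & I k' (run c s)) ->
  forall k s, I k s -> exists t s', [/\ exec (While b c) s t s', ~~ teval s' b,
    exists k', I k' s' & (t <= (csize c).+1 * k + 1)%N].
Proof.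
move=> lc step k; elim/ltn_ind: k => k IHk s Is.
have [bs|bs] := boolP (teval s b); last first.
  exists 1, s; split=> //; [exact: exec_While_false | by exists k | lia].
have [k' k'k Is'] := step _ _ Is bs; have [t1 e1 le1] := exec_run s lc.
have [t2 [s' [e2 bs' Is2 le2]]] := IHk _ k'k _ Is'.
exists (t1 + t2).+1, s'; split=> //; first exact: exec_While_true e1 e2.
have : ((csize c).+1 * k'.+1 <= (csize c).+1 * k)%N by rewrite leq_mul2l k'k orbT.
by rewrite mulnS; lia.
Qed.

Lemma exec_for (I : nat -> store K -> Prop) m b c : loopfree c ->
  (forall i s, I i s -> teval s b = (i < m)%N) ->
  (forall i s, I i s -> (i < m)%N -> I i.+1 (run c s)) ->
  forall s, I 0%N s -> exists t s', [/\ exec (While b c) s t s', I m s'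
    & (t <= (csize c).+1 * m + 1)%N].
Proof.
move=> lc bE step s I0.
pose J k s := (k <= m)%N /\ I (m - k)%N s.
have Jstep k s' : J k s' -> teval s' b -> exists2 k', (k' < k)%N & J k' (run c s').
  case=> km Is'; rewrite (bE _ _ Is') => lt; exists k.-1; first by lia.
  split; first by lia.
  by have -> : (m - k.-1 = (m - k).+1)%N by [lia]; apply: step.
have J0 : J m s by split; rewrite ?subnn.
have [t [s' [e bs' [k [km Is']] le]]] := exec_while lc Jstep J0.
exists t, s'; split=> //; rewrite (bE _ _ Is') -leqNgt in bs'.
by have -> : m = (m - k)%N by lia.
Qed.

(** * Renaming the arrays of a program *)

Section Rename.
Variable f : nat -> nat.
Hypothesis f_inj : injective f.

Fixpoint nren (e : nexp) : nexp :=
  match e with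
  | NConst k => NConst k
  | NGet a i => NGet (f a) (nren i)
  | NAdd e1 e2 => NAdd (nren e1) (nren e2)
  | NSub e1 e2 => NSub (nren e1) (nren e2)
  end.

Fixpoint fren (e : fexp) : fexp :=
  match e with
  | FZero => FZero
  | FOne => FOne
  | FGet a i => FGet (f a) (nren i)
  | FAdd e1 e2 => FAdd (fren e1) (fren e2)
  | FOpp e1 => FOpp (fren e1)
  | FMul e1 e2 => FMul (fren e1) (fren e2)
  | FInv e1 => FInv (fren e1)
  end.

Definition tren b : test :=
  match b with
  | TLt e1 e2 => TLt (nren e1) (nren e2)
  | TZero e => TZero (fren e)
  end.

Fixpoint ren c : cmd :=
  match c with
  | Skip => Skip
  | NSet a i e => NSet (f a) (nren i) (nren e)
  | FSet a i e => FSet (f a) (nren i) (fren e)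
  | Seq c1 c2 => Seq (ren c1) (ren c2)
  | If b c1 c2 => If (tren b) (ren c1) (ren c2)
  | While b c => While (tren b) (ren c)
  end.

Definition ren_store s s2 : Prop :=
  (forall a i, nats s2 (f a) i = nats s a i) /\ (forall a i, scals s2 (f a) i = scals s a i).

Definition same_outside s s' : Prop :=
  forall a, (forall a', f a' != a) ->
    (forall i, nats s' a i = nats s a i) /\ (forall i, scals s' a i = scals s a i).

Lemma neval_ren s s2 e : ren_store s s2 -> neval s2 (nren e) = neval s e.
Proof.
case=> sn _; elim: e => //= [a i IH|e1 IH1 e2 IH2|e1 IH1 e2 IH2]; by rewrite ?IH ?sn ?IH1 ?IH2.
Qed.

Lemma feval_ren s s2 e : ren_store s s2 -> feval s2 (fren e) = feval s e.
Proof.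
move=> ss; have [sn sf] := ss; elim: e => //= [a i|e1 -> e2 ->|e1 ->|e1 -> e2 ->|e1 ->] //.
by rewrite sf (neval_ren _ ss).
Qed.

Lemma teval_ren s s2 b : ren_store s s2 -> teval s2 (tren b) = teval s b.
Proof. by move=> ss; case: b => /= *; rewrite ?(feval_ren _ ss) ?(neval_ren _ ss). Qed.

Lemma upd_ren (T : Type) (g g2 : nat -> nat -> T) a i x :
  (forall a i, g2 (f a) i = g a i) ->
  forall a' i', upd g2 (f a) i x (f a') i' = upd g a i x a' i'.
Proof. by move=> gg a' i'; rewrite /upd (inj_eq f_inj) gg. Qed.

Lemma upd_outside (T : Type) (g : nat -> nat -> T) (a : nat) i x (b : nat) :
  (forall a', f a' != b) -> forall i', upd g (f a) i x b i' = g b i'.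
Proof. by move=> /(_ a)/negPf fb i'; rewrite /upd eq_sym fb. Qed.

(** Injectivity keeps distinct arrays apart, so the renamed program simulates the original step by
    step and writes only to arrays in the range of [f]. *)
Lemma exec_ren c s t s' s2 : exec c s t s' -> ren_store s s2 ->
  exists s2', [/\ exec (ren c) s2 t s2', ren_store s' s2' & same_outside s2 s2'].
Proof.
move=> ex; elim: ex s2 => {c s t s'}
  [s|a i e s|a i e s|c1 c2 s1 s2 s3 t1 t2 _ IH1 _ IH2|b c1 c2 s s' t bs _ IH
  |b c1 c2 s s' t bs _ IH|b c s bs|b c s1 s2 s3 t1 t2 bs _ IH1 _ IH2] r sr /=.
- by exists r; split=> //; exact: exec_Skip.
- eexists; split; first exact: exec_NSet.
    rewrite !(neval_ren _ sr); case: sr => sn sf; split=> //= a' i'; exact: upd_ren.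
  by move=> a' out; split=> //= i'; rewrite upd_outside.
- eexists; split; first exact: exec_FSet.
    rewrite (neval_ren _ sr) (feval_ren _ sr); case: sr => sn sf; split=> //= a' i'.
    exact: upd_ren.
  by move=> a' out; split=> //= i'; rewrite upd_outside.
- have [r2 [e1 sr2 so2]] := IH1 _ sr; have [r3 [e2 sr3 so3]] := IH2 _ sr2.
  exists r3; split=> //; first exact: exec_Seq e1 e2.
  by move=> a out; have [n2 f2] := so2 a out; have [n3 f3] := so3 a out; split=> i;
    rewrite ?n3 ?f3.
- have [r2 [e sr2 so]] := IH _ sr; exists r2; split=> //.
  by apply: exec_If_true; rewrite ?(teval_ren _ sr).
- have [r2 [e sr2 so]] := IH _ sr; exists r2; split=> //.
  by apply: exec_If_false; rewrite ?(teval_ren _ sr).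
- by exists r; split=> //; apply: exec_While_false; rewrite (teval_ren _ sr).
- have [r2 [e1 sr2 so2]] := IH1 _ sr; have [r3 [e2 sr3 so3]] := IH2 _ sr2.
  exists r3; split=> //; first by apply: exec_While_true e1 e2; rewrite (teval_ren _ sr).
  by move=> a out; have [n2 f2] := so2 a out; have [n3 f3] := so3 a out; split=> i;
    rewrite ?n3 ?f3.
Qed.

End Rename.
End Programs.

(** * Transposition *)

(* Cell i of array 6 of natural numbers is register i. The search keeps the head
   and the length of its queue in registers 3 and 4, the position in the current
   row in 5 and the next candidate for a root in 6. The other working arrays are:
   of natural numbers, 7 (the queue), 8 (marks of visited vertices) and 9 (number
   of entries met so far in each column); of field elements, 6 and 7 (C and R),
   8 (the entries of the transpose of M) and 9 (a copy of those of M). *)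
Definition reg i := NGet 6 (NConst i).
Definition setreg i e := NSet 6 (NConst i) e.
Definition increg i := setreg i (NAdd (reg i) (NConst 1)).

Fixpoint seqs (cs : seq cmd) : cmd :=
  match cs with
  | [::] => Skip
  | [:: c] => c
  | c :: cs => Seq c (seqs cs)
  end.

(** Register 0 is the current entry, register 1 its column, and register 2 the index of the mirrored
    entry, computed as in [row_offset_transpose]. Overwriting the value by 1 prepares the input of
    the adjacency matrix. *)
Definition transpose_body : cmd :=
  seqs [:: setreg 1 (NGet 2 (reg 0));
           setreg 2 (NAdd (NGet 1 (reg 1)) (NGet 9 (reg 1)));
           FSet 8 (reg 2) (FGet 0 (reg 0));
           FSet 9 (reg 0) (FGet 0 (reg 0));
           FSet 0 (reg 0) FOne;
           NSet 9 (reg 1) (NAdd (NGet 9 (reg 1)) (NConst 1));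
           increg 0].

(** The bound is the last row offset, that is, the number of nonzero entries. *)
Definition transpose_loop : cmd :=
  While (TLt (reg 0) (NGet 1 (NGet 0 (NConst 0)))) transpose_body.

Section Encoding.
Variables (K : fieldType) (n : nat) (M : 'M[K]_n).
Let nz := nz_pos M.

Lemma nats_encode1 i : (i <= n)%N -> nats (encode M) 1 i = row_offset M i.
Proof.
move=> i_n; transitivity (nth 0%N [seq row_offset M i | i <- iota 0 n.+1] i); first by [].
by rewrite (nth_map 0%N) ?size_iota ?ltnS // nth_iota ?ltnS.
Qed.

Lemma nats_encode2 p : p \in nz -> nats (encode M) 2 (index p nz) = p.2.
Proof. by move=> pnz; rewrite /= (nth_map p) ?index_mem // nth_index. Qed.

Lemma scals_encode0 p : p \in nz -> scals (encode M) 0 (index p nz) = M p.1 p.2.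
Proof. by move=> pnz; rewrite /= (nth_map p) ?index_mem // nth_index. Qed.

Lemma encode_unused a i : (2 < a)%N ->
  nats (encode M) a i = 0%N /\ scals (encode M) a i = 0.
Proof. by case: a => [|[|[|a]]] //= _; rewrite !nth_nil. Qed.

End Encoding.

Section Transpose.
Variables (K : fieldType) (n : nat) (M : 'M[K]_n).
Hypothesis Msym : forall u w, (M u w != 0) = (M w u != 0).
Let nz := nz_pos M.

Record transposed i (s : store K) : Prop := Transposed {
  tr_le : (i <= size nz)%N;
  tr_nats : forall a j, (a < 6)%N -> nats s a j = nats (encode M) a j;
  tr_ctr : nats s 6 0 = i;
  tr_regs : forall j, (2 < j)%N -> nats s 6 j = 0%N;
  tr_arrays : forall a j, (6 < a)%N -> a != 9%N -> nats s a j = 0%N;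
  tr_count : forall x : 'I_n, nats s 9 x = count (fun p => p.2 == x) (take i nz);
  tr_scals : forall a j, (a < 6)%N || (9 < a)%N ->
    scals s a j = if (a == 0%N) && (j < i)%N then 1 else scals (encode M) a j;
  tr_copy : {in take i nz, forall p, scals s 9 (index p nz) = M p.1 p.2};
  tr_transpose : {in take i nz, forall p, scals s 8 (index (p.2, p.1) nz) = M p.1 p.2} }.

Lemma run_transpose_body (s : store K) i x q : nats s 6 0 = i -> nats s 2 i = x ->
  (nats s 1 x + nats s 9 x)%N = q ->
  run transpose_body s =
  Store (upd (upd (upd (upd (nats s) 6 1 x) 6 2 q) 9 x (nats s 9 x + 1)%N) 6 0 (i + 1)%N)
        (upd (upd (upd (scals s) 8 q (scals s 0 i)) 9 i (scals s 0 i)) 0 i 1).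
Proof. by move=> <- <- <-. Qed.

Lemma transposed_encode : transposed 0 (encode M).
Proof.
split=> //.
- by move=> j _; have [-> _] := @encode_unused K n M 6 j isT.
- by move=> a j a6 _; have [-> _] := @encode_unused K n M a j ltac:(lia).
- by move=> x; rewrite take0; have [-> _] := @encode_unused K n M 9 x isT.
- by move=> a j _; rewrite ltn0 andbF.
- by move=> p; rewrite take0.
- by move=> p; rewrite take0.
Qed.

Lemma transposed_step i s : transposed i s -> (i < size nz)%N ->
  transposed i.+1 (run transpose_body s).
Proof.
move=> [_ T1 T2 T3 T4 T5 T6 T7 T8] i_lt.
have [p0 _] : {p0 | p0 \in nz} by case: nz i_lt => // p0 l; exists p0; rewrite mem_head.
set p := nth p0 nz i; have pnz : p \in nz by apply: mem_nth.
have ip : index p nz = i by rewrite index_uniq ?nz_pos_uniq.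
have takeS : take i.+1 nz = rcons (take i nz) p by rewrite (take_nth p0).
have t2i : nats s 2 i = p.2 by rewrite T1 // -ip nats_encode2.
have t1x : (nats s 1 p.2 + nats s 9 p.2)%N = index (p.2, p.1) nz.
  by rewrite T1 // nats_encode1 ?T5 1?ltnW // -row_offset_transpose // ip.
have s0i : scals s 0 i = M p.1 p.2.
  by rewrite T6 // ltnn andbF; move: (scals_encode0 pnz); rewrite ip.
have swap q : q \in nz -> (q.2, q.1) \in nz by rewrite !mem_nz_pos /= Msym.
rewrite (run_transpose_body T2 t2i t1x) s0i; split=> //; rewrite /upd /=.
- move=> a j a6; rewrite !(@ltn_eqF a) /= ?T1 //; lia.
- by rewrite addn1.
- by case=> [|[|[|j]]] //= _; rewrite T3.
- move=> a j a6 /negPf a9; rewrite a9 !(@gtn_eqF _ a) //= T4 ?a9 //.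
- move=> x /=; rewrite takeS -cats1 count_cat /= addn0 -!T5 [p.2 == x]eq_sym -val_eqE.
  by case: (x =P p.2 :> nat) => [->|_]; rewrite ?addn0.
- move=> a j a6; have [-> ->] : (a == 8) = false /\ (a == 9) = false by clear -a6; lia.
  rewrite /= ltnS leq_eqVlt T6 //; case: (a =P 0%N) => //= _.
  by case: eqP.
- move=> q; rewrite takeS mem_rcons inE; case: eqVneq => [-> _|qp /= qt].
    by rewrite ip eqxx.
  have /mem_take qnz := qt.
  suff /negPf -> : index q nz != i by apply: T7.
  by rewrite -ip; apply: contraNneq qp => /index_inj ->.
- move=> q; rewrite takeS mem_rcons inE; case: eqVneq => [-> _|qp /= qt].
    by rewrite eqxx.
  have /mem_take qnz := qt.
  (* Distinct entries have distinct targets, so earlier results are not overwritten. *)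
  suff /negPf -> : index (q.2, q.1) nz != index (p.2, p.1) nz by apply: T8.
  apply: contraNneq qp => /(@index_inj _ p0 nz _ _ (swap _ qnz) (swap _ pnz)).
  by case: (q) (p) => [? ?] [? ?] /= [-> ->].
Qed.

Lemma exec_transpose : exists t s,
  [/\ exec transpose_loop (encode M) t s, transposed (size nz) s
    & (t <= (csize transpose_body).+1 * size nz + 1)%N].
Proof.
apply: (exec_for (I := transposed)) => //; last exact: transposed_encode.
  move=> i s Ts /=; rewrite (tr_ctr Ts) !(tr_nats Ts) // nats_encode1 //=.
  by rewrite row_offset_max.
exact: transposed_step.
Qed.

End Transpose.

(** * Breadth-first search *)

Definition visit i cx rx : cmd :=
  seqs [:: FSet 6 (reg i) cx; FSet 7 (reg i) rx; NSet 8 (reg i) (NConst 1);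
           NSet 7 (reg 4) (reg i); increg 4].

Definition unvisited i := TLt (NGet 8 (reg i)) (NConst 1).

(** For the edge from [w] in register 9 to a new vertex [x] in register 8, the equations
    [M w x = r w * c x] and [M x w = r x * c w] are solved for [c x] and [r x]. *)
Definition scan_body : cmd :=
  Seq (setreg 8 (NGet 2 (reg 7)))
  (Seq (If (unvisited 8)
          (visit 8 (FMul (FGet 9 (reg 7)) (FInv (FGet 7 (reg 9))))
                   (FMul (FGet 8 (reg 7)) (FInv (FGet 6 (reg 9)))))
          Skip)
       (increg 5)).

Definition queue_body : cmd :=
  Seq (setreg 9 (NGet 7 (reg 3)))
  (Seq (setreg 7 (NAdd (NGet 1 (reg 9)) (reg 5)))
  (If (TLt (reg 7) (NGet 1 (NAdd (reg 9) (NConst 1))))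
     scan_body
     (Seq (increg 3) (setreg 5 (NConst 0))))).

Definition root_body : cmd :=
  Seq (If (unvisited 6) (visit 6 FOne FOne) Skip) (increg 6).

Definition search_body : cmd := If (TLt (reg 3) (reg 4)) queue_body root_body.

(** The nested loops of the search are flattened into one with a loop-free body. The guard is
    positive while the queue is nonempty or candidates for roots remain. *)
Definition search_loop : cmd :=
  While (TLt (NConst 0) (NAdd (NSub (reg 4) (reg 3)) (NSub (NGet 0 (NConst 0)) (reg 6))))
    search_body.

Section Search.
Variables (K : fieldType) (n : nat) (G : graph n) (M : 'M[K]_n).
Hypotheses (forestG : forest G) (MG : in_M0 G M).
Let nz := nz_pos M.
Implicit Types (Q : seq 'I_n) (h e rt : nat) (r c : 'I_n -> K) (s : store K).

Definition scaling r c : Prop :=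
  [/\ forall i, r i != 0, forall i, c i != 0 & forall u w, adj G u w -> M u w = r u * c w].

(** On the component of [x0], which is disjoint from [Q], the scaling is changed by one pair of
    factors per colour class. Every edge joins the two classes, where the factors cancel. This
    allows the search to start at each root with the value 1. *)
Lemma scaling_root r c Q x0 : scaling r c ->
  (forall w x, w \in Q -> adj G w x -> x \in Q) -> x0 \notin Q ->
  exists r' c', [/\ scaling r' c', {in Q, r' =1 r}, {in Q, c' =1 c},
                    r' x0 = 1 & c' x0 = 1].
Proof.
move=> [r0 c0 rcP] Qclosed x0Q; have [col colP] := forest_colouring forestG.
have Qadj : closed (adj G) (mem Q).
  by move=> x y xy; apply/idP/idP => [/Qclosed|/Qclosed]; apply; rewrite // adj_sym.
have QN y : y \in Q -> connect (adj G) x0 y = false.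
  by move=> yQ; apply: contraNF x0Q => /(closed_connect Qadj) /= ->.
pose kc y := if connect (adj G) x0 y then
               (if col y == col x0 then (c x0)^-1 else r x0) else 1.
pose kr y := if connect (adj G) x0 y then
               (if col y == col x0 then (r x0)^-1 else c x0) else 1.
have kc0 y : kc y != 0 by rewrite /kc; do ?[case: ifP => _]; rewrite ?invr_eq0 ?oner_eq0.
have kr0 y : kr y != 0 by rewrite /kr; do ?[case: ifP => _]; rewrite ?invr_eq0 ?oner_eq0.
exists (fun y => r y * kr y), (fun y => c y * kc y); split.
- split=> [i|i|u w uw]; rewrite ?mulf_neq0 // mulrACA -rcP //.
  rewrite /kr /kc -(same_connect_r (sym_connect_sym (adj_sym G)) (connect1 uw)).
  case: ifP => _; last by rewrite !mulr1.
  move: (colP _ _ uw); case: (col u) (col w) (col x0) => [] [] [] //= _;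
  by rewrite ?mulVf ?mulfV ?mulr1.
- by move=> y yQ; rewrite /kr QN // mulr1.
- by move=> y yQ; rewrite /kc QN // mulr1.
- by rewrite /kr connect0 eqxx mulfV.
- by rewrite /kc connect0 eqxx mulfV.
Qed.

(** [Q] lists the visited vertices in order of discovery. The rows of the first [h] are scanned
    completely, as are the first [e] entries of the next row; the candidates below [rt] have been
    visited. *)
Record frontier Q h e rt : Prop := Frontier {
  fr_uniq : uniq Q;
  fr_h : (h <= size Q)%N;
  fr_rt : (rt <= n)%N;
  fr_roots : forall x : 'I_n, (x < rt)%N -> x \in Q;
  fr_done : forall w x, w \in Q -> (index w Q < h)%N -> adj G w x -> x \in Q;
  fr_scanned : forall p, p \in nz -> p.1 \in Q -> index p.1 Q = h ->
    (index p nz < row_offset M p.1 + e)%N -> p.2 \in Q;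
  fr_e : forall w, w \in Q -> index w Q = h -> (row_offset M w + e <= row_offset M w.+1)%N;
  fr_e0 : h = size Q -> e = 0%N }.

(** The potential of the search. It uses [n - h] instead of [size Q - h], so that discovering a
    vertex does not increase it. *)
Definition remaining Q h e rt : nat :=
  ((n - rt) + (n - h) + (size nz - (count (fun p => index p.1 Q < h) nz + e)))%N.

Lemma index_cat_lt Q Q' h x : (h <= size Q)%N ->
  (index x (Q ++ Q') < h)%N = (index x Q < h)%N.
Proof.
move=> hQ; rewrite index_cat; case: ifP => // /negbT xQ.
by rewrite (memNindex xQ) ![(_ < h)%N]ltnNge hQ (leq_trans hQ (leq_addr _ _)).
Qed.

Lemma index_cat_eq Q Q' h x : (h < size Q)%N ->
  (index x (Q ++ Q') == h) = (index x Q == h).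
Proof.
move=> hQ; rewrite index_cat; case: ifP => // /negbT xQ.
by rewrite (memNindex xQ) !gtn_eqF // (leq_trans hQ (leq_addr _ _)).
Qed.

Lemma index_lt_mem Q h x : (h <= size Q)%N -> (index x Q < h)%N -> x \in Q.
Proof. by move=> hQ lt; rewrite -index_mem (leq_trans lt hQ). Qed.

Lemma index_eq_mem Q h x : (h < size Q)%N -> index x Q = h -> x \in Q.
Proof. by move=> hQ E; rewrite -index_mem E. Qed.

Lemma size_uniq_ord Q : uniq Q -> (size Q <= n)%N.
Proof. by move=> /card_uniqP <-; apply: leq_trans (max_card _) _; rewrite card_ord. Qed.

(** [Q'] is empty or holds the newly found vertex, so both outcomes of the test for visited vertices
    are covered. *)
Lemma frontier_scan Q Q' h e rt w p : frontier Q h e rt -> uniq (Q ++ Q') ->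
  w \in Q -> index w Q = h -> (row_offset M w + e < row_offset M w.+1)%N ->
  p \in nz -> index p nz = (row_offset M w + e)%N -> p.2 \in Q ++ Q' ->
  frontier (Q ++ Q') h e.+1 rt /\
  (remaining (Q ++ Q') h e.+1 rt < remaining Q h e rt)%N.
Proof.
move=> [Quniq hQ rtn roots done scanned eQ e0] QQ'uniq wQ wh lt pnz pidx pQ'.
have hlt : (h < size Q)%N by rewrite -wh index_mem.
have p1 : p.1 = w.
  have [|_] := @nth_nz_pos_row _ _ M w p (row_offset M w + e); last first.
    by rewrite -pidx nth_index.
  by rewrite leq_addr.
split.
  split=> //.
  - by rewrite size_cat; lia.
  - by move=> x /roots; rewrite mem_cat => ->.
  - move=> u x _; rewrite index_cat_lt // => lth ux; rewrite mem_cat.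
    by rewrite (done u) // (index_lt_mem hQ).
  - move=> q qnz _ /eqP; rewrite index_cat_eq // => /eqP qh.
    have qQ := index_eq_mem hlt qh.
    have qw : q.1 = w by rewrite -(nth_index w qQ) qh -wh nth_index.
    rewrite addnS ltnS leq_eqVlt => /orP[/eqP qidx|]; last first.
      by move/(scanned _ qnz qQ qh); rewrite mem_cat => ->.
    suff -> : q = p by [].
    by apply: (@index_inj _ p nz) => //; rewrite qidx pidx qw.
  - move=> u _ /eqP; rewrite index_cat_eq // => /eqP uh.
    have uw : u = w by rewrite -(nth_index w (index_eq_mem hlt uh)) uh -wh nth_index.
    by rewrite uw addnS.
  - by rewrite size_cat => hE; move: hlt; rewrite hE; lia.
rewrite /remaining ltn_add2l.
rewrite (@eq_count _ _ (fun q => index q.1 Q < h)%N) => [|q]; last exact: index_cat_lt.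
(* Row [w] still has an unscanned entry, so the truncated difference does drop. *)
have lt' : (count (fun q => index q.1 Q < h)%N nz + e < size nz)%N.
  apply: (@leq_trans (count (fun q => index q.1 Q < h)%N nz
                      + count (fun q => q.1 == w) nz)); last first.
    rewrite -count_disjointU ?count_size // => q.
    by apply: contraTneq => ->; rewrite wh ltnn.
  by rewrite ltn_add2l; move: lt; rewrite row_offsetS ltn_add2l.
by rewrite addnS; lia.
Qed.

Lemma frontier_next Q h e rt w : frontier Q h e rt ->
  w \in Q -> index w Q = h -> (row_offset M w.+1 <= row_offset M w + e)%N ->
  frontier Q h.+1 0 rt /\ (remaining Q h.+1 0 rt < remaining Q h e rt)%N.
Proof.
move=> [Quniq hQ rtn roots done scanned eQ e0] wQ wh le.
have hlt : (h < size Q)%N by rewrite -wh index_mem.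
have eE : (row_offset M w + e = row_offset M w.+1)%N.
  by apply/eqP; rewrite eqn_leq le eQ.
split.
  split=> //.
  - move=> u x uQ; rewrite ltnS leq_eqVlt => /orP[/eqP uh|]; last exact: done.
    have uw : u = w by rewrite -(nth_index w uQ) uh -wh nth_index.
    move=> ux; have pnz : (u, x) \in nz by rewrite mem_nz_pos (in_M0_neq0 _ _ MG).
    apply: (scanned (u, x)) => //=.
    by have /andP[_] := index_nz_pos_row pnz; rewrite /= uw eE.
  - move=> q qnz _ _; rewrite addn0 => lt.
    by have := index_nz_pos_row qnz; rewrite leqNgt lt.
  - by move=> u _ _; rewrite addn0 row_offset_le.
have hn : (h < n)%N := leq_trans hlt (size_uniq_ord Quniq).
rewrite /remaining addn0.
(* The [e] scanned entries form the whole row of [w], which now counts as finished; only [n - h]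
   drops. *)
have -> : count (fun p => index p.1 Q < h.+1)%N nz
          = (count (fun p => index p.1 Q < h)%N nz + e)%N.
  have -> : e = count (fun p => p.1 == w) nz.
    by apply/eqP; rewrite -(eqn_add2l (row_offset M w)) eE row_offsetS.
  rewrite -count_disjointU => [|q]; last by apply: contraTneq => ->; rewrite wh ltnn.
  apply: eq_count => q /=; rewrite ltnS leq_eqVlt orbC; congr (_ || _).
  apply/eqP/eqP => [qh|->//].
  by rewrite -(nth_index w (index_eq_mem hlt qh)) qh -wh nth_index.
by lia.
Qed.

Lemma frontier_root Q Q' h e rt (x : 'I_n) : frontier Q h e rt -> uniq (Q ++ Q') ->
  h = size Q -> x = rt :> nat -> x \in Q ++ Q' ->
  frontier (Q ++ Q') h e rt.+1 /\
  (remaining (Q ++ Q') h e rt.+1 < remaining Q h e rt)%N.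
Proof.
move=> [Quniq hQ rtn roots done scanned eQ e0] QQ'uniq hE xrt xQ.
have rt_lt : (rt < n)%N by rewrite -xrt.
split.
  split=> //.
  - by rewrite size_cat; lia.
  - move=> y; rewrite ltnS leq_eqVlt => /orP[/eqP yrt|/roots]; last by rewrite mem_cat => ->.
    by have -> : y = x by apply: val_inj; rewrite /= yrt xrt.
  - move=> u y _; rewrite index_cat_lt // => lth uy; rewrite mem_cat.
    by rewrite (done u) // (index_lt_mem hQ).
  - move=> q qnz _ _; rewrite e0 // addn0 => lt.
    by have := index_nz_pos_row qnz; rewrite leqNgt lt.
  - by move=> u _ _; rewrite e0 // addn0 row_offset_le.
  - by move=> _; exact: e0.
rewrite /remaining.
rewrite (@eq_count _ _ (fun q => index q.1 Q < h)%N) => [|q]; last exact: index_cat_lt.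
by lia.
Qed.

(** [r] and [c] scale all of [M]; the arrays 6 and 7 are required to agree with them only on visited
    vertices. *)
Record core s Q r c : Prop := Core {
  co_nats : forall a j, (a < 6)%N -> nats s a j = nats (encode M) a j;
  co_zero : forall a j, (9 < a)%N -> nats s a j = 0%N;
  co_regs : forall j, (9 < j)%N -> nats s 6 j = 0%N;
  co_scals : forall a j, (a < 6)%N || (9 < a)%N ->
    scals s a j = if (a == 0%N) && (j < size nz)%N then 1 else scals (encode M) a j;
  co_copy : {in nz, forall p, scals s 9 (index p nz) = M p.1 p.2};
  co_transpose : {in nz, forall p, scals s 8 (index p nz) = M p.2 p.1};
  co_scaling : scaling r c;
  co_size : nats s 6 4 = size Q;
  co_queue : {in Q, forall w : 'I_n, nats s 7 (index w Q) = w};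
  co_mark : forall x : 'I_n, nats s 8 x = (x \in Q);
  co_col : {in Q, forall x : 'I_n, scals s 6 x = c x};
  co_row : {in Q, forall x : 'I_n, scals s 7 x = r x} }.

Lemma core_setreg s Q r c i v : core s Q r c -> (i < 10)%N -> i != 4%N ->
  core (Store (upd (nats s) 6 i v) (scals s)) Q r c.
Proof.
case=> C1 C2 C3 C4 C5 C6 C7 C8 C9 C10 C11 C12 i10 i4; split=> //; rewrite /upd /=.
- by move=> a j a6; rewrite ltn_eqF //= C1.
- by move=> a j a9; rewrite gtn_eqF ?C2 // (leq_trans _ a9).
- by move=> j j9; rewrite [j == i]gtn_eqF ?C3 // (leq_trans i10).
- by rewrite eq_sym (negPf i4).
Qed.

Lemma run_visit s i cx rx x t vc vr : nats s 6 i = x -> nats s 6 4 = t ->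
  feval s cx = vc -> feval (Store (nats s) (upd (scals s) 6 x vc)) rx = vr ->
  run (visit i cx rx) s =
  Store (upd (upd (upd (nats s) 8 x 1%N) 7 t x) 6 4 (t + 1)%N)
        (upd (upd (scals s) 6 x vc) 7 x vr).
Proof. by move=> <- <- <- <-. Qed.

Lemma core_visit s Q r c i cx rx x : core s Q r c -> x \notin Q -> nats s 6 i = x ->
  feval s cx = c x -> feval (Store (nats s) (upd (scals s) 6 x (c x))) rx = r x ->
  core (run (visit i cx rx) s) (Q ++ [:: x]) r c /\
  (forall j, j != 4%N -> nats (run (visit i cx rx) s) 6 j = nats s 6 j).
Proof.
case=> C1 C2 C3 C4 C5 C6 C7 C8 C9 C10 C11 C12 xQ ix cxE rxE.
rewrite (run_visit ix C8 cxE rxE); split; last first.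
  by move=> j /negPf j4; rewrite /= /upd /= j4.
have ordE (y z : 'I_n) : (y == z :> nat) = (y == z) by [].
split=> //; rewrite /upd /=.
- by move=> a j a6; rewrite !(@ltn_eqF a) /= ?C1 // ltnW // ltnW.
- by move=> a j a9; rewrite !(@gtn_eqF _ a) /= ?C2 // ?(leq_trans _ a9).
- by move=> j j9; rewrite gtn_eqF ?C3 // (leq_trans _ j9).
- move=> a j a69; have [-> ->] : (a == 7) = false /\ (a == 6) = false.
    by clear -a69; lia.
  exact: C4.
- by rewrite size_cat addn1.
- move=> w; rewrite mem_cat inE index_cat; have [wQ _|wQ /= /eqP wx] := boolP (w \in Q).
    by rewrite ltn_eqF ?index_mem //= C9.
  by rewrite wx eqxx addn0 eqxx.
- move=> y; rewrite mem_cat inE ordE; case: eqVneq => [->|_]; first by rewrite orbT.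
  by rewrite orbF C10.
- move=> y; rewrite mem_cat inE ordE; case: eqVneq => [->|_] //.
  by rewrite orbF => /C11.
- move=> y; rewrite mem_cat inE ordE; case: eqVneq => [->|_] //.
  by rewrite orbF => /C12.
Qed.

Lemma core_scaling s Q r c r' c' : core s Q r c -> scaling r' c' ->
  {in Q, r' =1 r} -> {in Q, c' =1 c} -> core s Q r' c'.
Proof.
case=> C1 C2 C3 C4 C5 C6 C7 C8 C9 C10 C11 C12 rc' rr' cc'; split=> // x xQ.
  by rewrite cc' // C11.
by rewrite rr' // C12.
Qed.

Definition search_inv (k : nat) s : Prop :=
  exists Q h e rt r c, [/\ core s Q r c,
    nats s 6 3 = h /\ nats s 6 5 = e, nats s 6 6 = rt,
    frontier Q h e rt & remaining Q h e rt = k].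

Lemma run_Seq (d1 d2 : cmd) s : run (Seq d1 d2) s = run d2 (run d1 s).
Proof. by []. Qed.

Lemma run_If b (d1 d2 : cmd) s :
  run (If b d1 d2) s = if teval s b then run d1 s else run d2 s.
Proof. by []. Qed.

Lemma core_run_setreg s Q r c i x : core s Q r c -> (i < 10)%N -> i != 4%N ->
  [/\ core (run (setreg i x) s) Q r c, nats (run (setreg i x) s) 6 i = neval s x
    & forall j, j != i -> nats (run (setreg i x) s) 6 j = nats s 6 j].
Proof.
move=> C i10 i4; split; first exact: core_setreg; rewrite /= /upd /=; first by rewrite eqxx.
by move=> j /negPf ->.
Qed.

Lemma core_unvisited s Q r c i (x : 'I_n) : core s Q r c -> nats s 6 i = x ->
  teval s (unvisited i) = (x \notin Q).
Proof. by move=> C ix; rewrite /= ix (co_mark C) ltnS leqn0 eqb0. Qed.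

Lemma core_row_offset s Q r c i : core s Q r c -> (i <= n)%N -> nats s 1 i = row_offset M i.
Proof. by move=> C i_n; rewrite (co_nats C) // nats_encode1. Qed.

Lemma scan_step s Q r c h e rt w : core s Q r c -> frontier Q h e rt ->
  w \in Q -> index w Q = h -> (row_offset M w + e < row_offset M w.+1)%N ->
  nats s 6 3 = h -> nats s 6 5 = e -> nats s 6 6 = rt ->
  nats s 6 9 = w -> nats s 6 7 = (row_offset M w + e)%N ->
  exists2 k', (k' < remaining Q h e rt)%N & search_inv k' (run scan_body s).
Proof.
move=> C F wQ wh lt s3 s5 s6 s9 s7.
have [e_lt] := @nth_nz_pos_row _ _ M w (w, w) (row_offset M w + e) ltac:(by rewrite leq_addr).
set p := nth _ _ _ => p1; have pnz : p \in nz by apply: mem_nth.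
have pidx : index p nz = (row_offset M w + e)%N by rewrite index_uniq ?nz_pos_uniq.
have wp : adj G w p.2 by move: pnz; rewrite mem_nz_pos (in_M0_neq0 _ _ MG) p1.
rewrite /scan_body run_Seq.
have [|//|C' r8 r_] := core_run_setreg (i := 8) (NGet 2 (reg 7)) C; first by [].
have {r8} r8 : nats (run (setreg 8 (NGet 2 (reg 7))) s) 6 8 = p.2.
  by rewrite r8 /= s7 (co_nats C) // -pidx nats_encode2.
move: (run _ s) C' r8 r_ => s' C' r8 r_; rewrite run_Seq run_If (core_unvisited C' r8).
have [r0 c0 rcP] := co_scaling C.
have finish s2 Q' : core s2 (Q ++ Q') r c -> p.2 \in Q ++ Q' -> uniq (Q ++ Q') ->
    (forall j, j != 4%N -> nats s2 6 j = nats s' 6 j) ->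
    exists2 k', (k' < remaining Q h e rt)%N & search_inv k' (run (increg 5) s2).
  move=> C2 pQ' QQ' s2E.
  have [F' lt'] := frontier_scan F QQ' wQ wh lt pnz pidx pQ'.
  exists (remaining (Q ++ Q') h e.+1 rt) => //.
  have [//|//|C3 r5 r5'] := core_run_setreg (i := 5) (NAdd (reg 5) (NConst 1)) C2.
  exists (Q ++ Q'), h, e.+1, rt, r, c; split=> //.
    by split; rewrite ?r5 ?r5' //= s2E ?r_ ?s5 ?addn1.
  by rewrite r5' // s2E // r_.
case: ifP => [xQ|/negbFE xQ]; last first.
  by apply: (finish _ [::]); rewrite ?cats0 //; case: F.
have vc : feval s' (FMul (FGet 9 (reg 7)) (FInv (FGet 7 (reg 9)))) = c p.2.
  rewrite /= !r_ // s7 s9 -pidx (co_copy C') // (co_row C') // p1.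
  by rewrite rcP // mulrAC mulfV ?mul1r.
have vr : feval (Store (nats s') (upd (scals s') 6 p.2 (c p.2)))
            (FMul (FGet 8 (reg 7)) (FInv (FGet 6 (reg 9)))) = r p.2.
  (* The entry of C just written belongs to another vertex than [w], so the value read at [w] is the
     old one. *)
  have wx : (w == p.2 :> nat) = false by apply/negbTE/(adj_neq wp).
  rewrite /= !r_ // s7 s9 /upd /= wx (co_col C') //.
  by rewrite -pidx (co_transpose C') // p1 rcP 1?adj_sym // mulfK.
have [C2 s2E] := core_visit C' xQ r8 vc vr.
apply: (finish _ [:: p.2] C2) => //; first by rewrite mem_cat inE eqxx orbT.
by rewrite cats1 rcons_uniq xQ; case: F.
Qed.

Lemma search_step k s : search_inv k s ->
  teval s (TLt (NConst 0) (NAdd (NSub (reg 4) (reg 3)) (NSub (NGet 0 (NConst 0)) (reg 6)))) ->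
  exists2 k', (k' < k)%N & search_inv k' (run search_body s).
Proof.
move=> [Q [h [e [rt [r [c [C [s3 s5] s6 F <-]]]]]]].
move=> notdone; rewrite /= s3 s6 (co_size C) (co_nats C) //= in notdone.
have test : teval s (TLt (reg 3) (reg 4)) = (h < size Q)%N by rewrite /= s3 (co_size C).
rewrite /search_body run_If test; case: ltnP => hQ.
  have [x0 _] : exists x0, x0 \in Q by case: (Q) hQ => // x0 l; exists x0; rewrite mem_head.
  pose w := nth x0 Q h; have wQ : w \in Q by apply: mem_nth.
  have wh : index w Q = h by rewrite index_uniq //; case: F.
  rewrite /queue_body run_Seq.
  have [//|//|] := core_run_setreg (i := 9) (NGet 7 (reg 3)) C.
  rewrite [neval _ _]/= s3 -{1}wh (co_queue C) //.
  move: (run _ s) => s' C' s'9 s'_; rewrite run_Seq.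
  have [//|//|] := core_run_setreg (i := 7) (NAdd (NGet 1 (reg 9)) (reg 5)) C'.
  rewrite [neval _ _]/= s'9 s'_ // s5 (core_row_offset C') 1?ltnW //.
  move: (run _ s') => s2 C2 s27 s2_.
  have s29 : nats s2 6 9 = w by rewrite s2_.
  have test2 : teval s2 (TLt (reg 7) (NGet 1 (NAdd (reg 9) (NConst 1))))
      = (row_offset M w + e < row_offset M w.+1)%N.
    by rewrite /= s27 s29 addn1 (core_row_offset C2).
  rewrite run_If test2; case: ltnP => lt.
    by apply: (scan_step C2 F wQ wh lt) => //; rewrite s2_ // s'_.
  have [F' lt'] := frontier_next F wQ wh lt; exists (remaining Q h.+1 0 rt) => //.
  rewrite run_Seq.
  have [//|//|] := core_run_setreg (i := 3) (NAdd (reg 3) (NConst 1)) C2.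
  rewrite [neval _ _]/= s2_ // s'_ // s3 addn1; move: (run _ s2) => s4 C4 s43 s4_.
  have [//|//|C5 s55 s5_] := core_run_setreg (i := 5) (NConst 0) C4.
  exists Q, h.+1, 0%N, rt, r, c; split=> //.
  by rewrite s5_ // s4_ // s2_ // s'_.
have hE : h = size Q by apply/eqP; rewrite eqn_leq hQ andbT; case: F.
have rt_lt : (rt < n)%N by move: notdone; rewrite hE subnn add0n subn_gt0.
have e0 : e = 0%N by case: F => _ _ _ _ _ _ _; apply.
pose x := Ordinal rt_lt; rewrite /root_body run_Seq run_If.
have s6x : nats s 6 6 = x by rewrite s6.
have finish s2 Q' r' c' : core s2 (Q ++ Q') r' c' -> x \in Q ++ Q' -> uniq (Q ++ Q') ->
    (forall j, j != 4%N -> nats s2 6 j = nats s 6 j) ->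
    exists2 k', (k' < remaining Q h e rt)%N & search_inv k' (run (increg 6) s2).
  move=> C2 xQ' QQ' s2E.
  have [F' lt'] := frontier_root F QQ' hE (erefl : x = rt :> nat) xQ'.
  exists (remaining (Q ++ Q') h e rt.+1) => //.
  have [//|//|C3 r6 r6'] := core_run_setreg (i := 6) (NAdd (reg 6) (NConst 1)) C2.
  exists (Q ++ Q'), h, e, rt.+1, r', c'; split=> //.
    by rewrite !r6' // !s2E.
  by rewrite r6 /= s2E // s6 addn1.
rewrite (core_unvisited C s6x); case: ifP => [xQ|/negbFE xQ]; last first.
  by apply: (finish _ [::] r c); rewrite ?cats0 //; case: F.
(* With the queue exhausted, the visited set is a union of components, and the scaling may be
   normalised at the new root. *)
have Qclosed w y : w \in Q -> adj G w y -> y \in Q.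
  by move=> wQ; apply: (fr_done F) => //; rewrite hE index_mem.
have [r' [c' [rc' rr' cc' r1 c1]]] := scaling_root (co_scaling C) Qclosed xQ.
have C' := core_scaling C rc' rr' cc'.
have [|//|C2 s2E] := core_visit (cx := FOne) (rx := FOne) C' xQ s6x; first by rewrite c1.
apply: (finish _ [:: x] r' c') => //; first by rewrite mem_cat inE eqxx orbT.
by rewrite cats1 rcons_uniq xQ; case: F.
Qed.

Lemma search_transposed s : transposed M (size nz) s -> search_inv (2 * n + size nz) s.
Proof.
case=> _ T1 T2 T3 T4 T5 T6; rewrite take_size => T7 T8.
have [r [c rcP]] := forest_scaling forestG MG.
have Msym u w : (M u w != 0) = (M w u != 0) by rewrite !(in_M0_neq0 _ _ MG) adj_sym.
exists [::], 0%N, 0%N, 0%N, r, c; split; rewrite ?T3 //.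
- split=> //.
  + by move=> a j a9; apply: T4; rewrite ?gtn_eqF // (leq_trans _ a9).
  + by move=> j j9; apply: T3; rewrite (leq_trans _ j9).
  + move=> p pnz; have := T8 (p.2, p.1); rewrite -surjective_pairing; apply.
    by rewrite mem_nz_pos /= Msym -mem_nz_pos.
  + by rewrite T3.
  + by move=> x; rewrite T4.
- by rewrite /remaining (@eq_count _ _ pred0) // count_pred0 !subn0 mul2n -addnn.
Qed.

Lemma exec_search s : transposed M (size nz) s -> exists t s' c r,
  [/\ exec search_loop s t s', scaling r c,
    [/\ forall a j, (a < 6)%N -> nats s' a j = nats (encode M) a j,
        forall a j, (9 < a)%N -> nats s' a j = 0%N, nats s' 6 10 = 0%N &
        forall a j, (a < 6)%N || (9 < a)%N ->
          scals s' a j = if (a == 0%N) && (j < size nz)%N then 1 else scals (encode M) a j],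
    (forall x : 'I_n, scals s' 6 x = c x)
    & (t <= (csize search_body).+1 * (2 * n + size nz) + 1)%N].
Proof.
move=> /search_transposed I0.
have [//|t [s' [ex done [k [Q [h [e [rt [r [c [C [s3 s5] s6 F _]]]]]]]] le]]] :=
  exec_while _ search_step I0.
(* The failing guard means that no candidate for a root is left. *)
have Qall x : x \in Q.
  apply: (fr_roots F); move: done; rewrite /= s3 s6 (co_size C) (co_nats C) //=.
  by rewrite -leqNgt leqn0 addn_eq0 !subn_eq0 => /andP[_] /(leq_trans (ltn_ord x)).
exists t, s', c, r; split=> //; first exact: co_scaling C.
  by split; [apply: (co_nats C) | apply: (co_zero C) | apply: (co_regs C) | apply: (co_scals C)].
by move=> x; apply: (co_col C).
Qed.

End Search.

(** * Reduction to adjacency matrices *)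

(** Register 10 is still zero at this point: the transposition and the search leave it alone, and
    the renamed program avoids array 6. *)
Definition scale_body : cmd :=
  Seq (FSet 1 (reg 10) (FMul (FInv (FGet 6 (NGet 5 (reg 10)))) (FGet 1 (reg 10))))
      (increg 10).

Definition scale_loop : cmd := While (TLt (reg 10) (NGet 3 (NConst 1))) scale_body.

(* Frees the arrays 6 to 15 for the pre- and postprocessing of a program. *)
Definition shift_array (a : nat) : nat := if (a < 6)%N then a else (a + 10)%N.

Lemma shift_array_inj : injective shift_array.
Proof. by move=> a b; rewrite /shift_array; case: (ltnP a 6) => ?; case: (ltnP b 6) => ? ?; lia. Qed.

Lemma shift_array_avoid a b : (5 < a < 16)%N -> shift_array b != a.
Proof. by move=> ?; rewrite /shift_array; case: (ltnP b 6) => ?; lia. Qed.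

(** * Scaling the output in coordinate format *)

Section OutputScaling.
Variables (K : fieldType) (n : nat).
Implicit Types (s : store K) (B : seq 'cV[K]_n) (c : 'I_n -> K).

Lemma size_nonzero_entries B :
  size [seq p <- [seq (j, nat_of_ord i, (B`_j : 'cV[K]_n) i 0)
                   | j <- iota 0 (size B), i <- enum 'I_n] | p.2 != 0] = nnz B.
Proof.
rewrite size_filter -sum1_count big_mkcond big_allpairs_dep /nnz [RHS](big_nth 0).
rewrite /index_iota subn0; apply: eq_bigr => j _.
by rewrite -big_mkcond big_enum_cond /= sum1dep_card.
Qed.

Lemma output_size s B : output s B -> nats s 3 1 = nnz B.
Proof. by case=> _ /perm_size; rewrite size_map size_iota size_nonzero_entries. Qed.

(** Nonzero factors preserve the positions of nonzero entries, so the new list is the image of the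
    old one under [g]. *)
Lemma output_scale s s' B c : output s B -> (forall i, c i != 0) ->
  (forall j, nats s' 3 j = nats s 3 j) -> (forall j, nats s' 4 j = nats s 4 j) ->
  (forall j, nats s' 5 j = nats s 5 j) ->
  (forall i : 'I_n, scals s' 6 i = c i) ->
  (forall j, (j < nats s 3 1)%N ->
     scals s' 1 j = (scals s' 6 (nats s 5 j))^-1 * scals s 1 j) ->
  output s' (map (scale (fun i => (c i)^-1)) B).
Proof.
move=> [sB pB] c0 s3 s4 s5 s6 s1; split; first by rewrite s3 size_map.
pose g (p : nat * nat * K) := (p.1.1, p.1.2, (scals s' 6 p.1.2)^-1 * p.2).
rewrite s3; have -> : [seq (nats s' 4 e, nats s' 5 e, scals s' 1 e) | e <- iota 0 (nats s 3 1)]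
  = map g [seq (nats s 4 e, nats s 5 e, scals s 1 e) | e <- iota 0 (nats s 3 1)].
  rewrite -map_comp; apply/eq_in_map => e; rewrite mem_iota add0n => /andP[_ e_lt] /=.
  by rewrite /g /= s4 s5 s1.
apply: perm_trans (perm_map g pB) _.
have -> : [seq (j, nat_of_ord i, ((map (scale (fun i => (c i)^-1)) B)`_j : 'cV[K]_n) i 0)
     | j <- iota 0 (size (map (scale (fun i => (c i)^-1)) B)), i <- enum 'I_n]
  = map g [seq (j, nat_of_ord i, (B`_j : 'cV[K]_n) i 0) | j <- iota 0 (size B), i <- enum 'I_n].
  rewrite map_allpairs size_map; apply/eq_in_allpairs => j i.
  rewrite mem_iota add0n => /andP[_ jB] _.
  by rewrite /g /= (nth_map 0) // scaleE s6.
rewrite [X in perm_eq _ X]filter_map; apply: perm_map; set L := [seq _ | _ <- _, _ <- _].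
have E : {in L, preim g (fun p => p.2 != 0) =1 (fun p => p.2 != 0)}.
  move=> p /allpairsP[[j i] [_ _ ->]] /=.
  by rewrite s6 mulf_eq0 invr_eq0 (negPf (c0 i)).
by rewrite (eq_in_filter E).
Qed.

Lemma exec_scale s : nats s 6 10 = 0%N -> exists t s',
  [/\ exec scale_loop s t s',
      forall a j, a != 6%N -> nats s' a j = nats s a j,
      forall j, scals s' 6 j = scals s 6 j,
      forall j, (j < nats s 3 1)%N ->
        scals s' 1 j = (scals s 6 (nats s 5 j))^-1 * scals s 1 j
    & (t <= (csize scale_body).+1 * nats s 3 1 + 1)%N].
Proof.
move=> s0; pose I i s' := [/\ nats s' 6 10 = i,
  forall a j, a != 6%N -> nats s' a j = nats s a j,
  forall j, scals s' 6 j = scals s 6 j &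
  forall j, scals s' 1 j = if (j < i)%N then (scals s 6 (nats s 5 j))^-1 * scals s 1 j
                           else scals s 1 j].
have [|i s' [I0 I1 _ _] /=|i s' [I0 I1 I2 I3] _||t [s' [ex [_ I1 I2 I3] le]]] :=
    @exec_for K I (nats s 3 1) (TLt (reg 10) (NGet 3 (NConst 1))) scale_body _ _ _ s _.
- by [].
- by rewrite I0 I1.
- have -> : run scale_body s' = Store (upd (nats s') 6 10 (nats s' 6 10 + 1)%N)
    (upd (scals s') 1 (nats s' 6 10)
         ((scals s' 6 (nats s' 5 (nats s' 6 10)))^-1 * scals s' 1 (nats s' 6 10))) by [].
  rewrite I0; split; rewrite /upd /=.
  + by rewrite addn1.
  + by move=> a j /negPf a6; rewrite a6 /= I1 ?a6.
  + exact: I2.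
  + move=> j; rewrite ltnS leq_eqVlt; case: eqP => [->|_] /=; last by rewrite I3.
    by rewrite I3 ltnn I2 I1.
- by split=> // j; rewrite ltn0.
by exists t, s'; split=> // j lt; rewrite I3 lt.
Qed.

End OutputScaling.

(** * The combined program and its running time *)

Section Reduction.
Variable K : fieldType.

(** Seen through the renaming, the store is a fresh input: ones at the nonzero positions, and zeros
    in the arrays from 6 on, which are moved to 16 and beyond. *)
Lemma ren_encode n (G : graph n) (M : 'M[K]_n) s : in_M0 G M ->
  (forall a j, (a < 6)%N -> nats s a j = nats (encode M) a j) ->
  (forall a j, (9 < a)%N -> nats s a j = 0%N) ->
  (forall a j, (a < 6)%N || (9 < a)%N -> scals s a j =
     if (a == 0%N) && (j < size (nz_pos M))%N then 1 else scals (encode M) a j) ->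
  ren_store shift_array (encode (adjmx K G)) s.
Proof.
move=> MG s1 s2 s3; have nzE := in_M0_nz_pos MG.
have unused (N : 'M[K]_n) a j := @encode_unused K n N a j.
split=> a j; rewrite /shift_array; case: ltnP => a6.
- by rewrite s1 // /encode nzE.
- have [-> _] : _ := unused (adjmx K G) a j ltac:(by apply: leq_trans a6).
  by rewrite s2 // (leq_trans _ (leq_addl _ _)).
- rewrite s3 ?a6 //; case: a a6 => [|a] a6 /=; last by case: a {a6} => [|a]; rewrite ?nth_nil.
  rewrite nzE; case: ltnP => jnz; last by rewrite !nth_default ?size_map.
  have [p0 _] : exists p0, p0 \in nz_pos M.
    by case: (nz_pos M) jnz => // p0 l _; exists p0; rewrite mem_head.
  have := mem_nth p0 jnz; rewrite -nzE mem_nz_pos nzE (nth_map p0) // mxE.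
  by case: (adj _ _ _); rewrite ?eqxx.
- rewrite s3; last by rewrite (leq_trans _ (leq_addl _ _)) ?orbT.
  have [_ ->] : _ := unused (adjmx K G) a j ltac:(by apply: leq_trans a6).
  have [_ ->] : _ := unused M (a + 10)%N j ltac:(by rewrite (leq_trans _ (leq_addl _ _))).
  by rewrite addn_eq0 andbF.
Qed.

Lemma acyclic_program P : finds_sparsest_basis_in_optimal_time (@forest_adjmx K) P ->
  finds_sparsest_basis_in_optimal_time (@acyclic_mx K)
    (Seq transpose_loop (Seq search_loop (Seq (ren shift_array P) scale_loop))).
Proof.
case=> c0 PP.
pose k1 := (csize transpose_body).+1; pose k2 := (csize search_body).+1.
pose k3 := (csize scale_body).+1.
(* There are at most [2 n] nonzero entries, hence at most [2 n] rounds of transposition and [4 n] of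
   search; the 3 pays for the last tests of the three loops. *)
exists (2 * k1 + 4 * k2 + c0 + k3 + 3)%N => n M [G forG MG].
have Msym u w : (M u w != 0) = (M w u != 0) by rewrite !(in_M0_neq0 _ _ MG) adj_sym.
have [t1 [s1 [ex1 tr1 le1]]] := exec_transpose Msym.
have [t2 [s2 [c [r [ex2 [r0 c0' rcP] [s2n s2z s2r s2s] s2c le2]]]]] := exec_search forG MG tr1.
have [t [s [B [exP out minB le]]]] := PP n (adjmx K G) (ex_intro2 _ _ G forG erefl).
have [s3 [ex3 [s3n s3s] s3o]] := exec_ren shift_array_inj exP (ren_encode MG s2n s2z s2s).
have [s36n s36s] := s3o 6 (fun a => @shift_array_avoid 6 a isT).
have [|t4 [s4 [ex4 s4n s4c s4s le4]]] := @exec_scale K s3; first by rewrite s36n.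
have out3 a j : (a < 6)%N -> nats s3 a j = nats s a j.
  by move=> a6; rewrite -s3n /shift_array a6.
have out' : output s3 B.
  have [sB pB] := out; split; rewrite !out3 //.
  rewrite (@eq_map _ _ _ (fun e => (nats s 4 e, nats s 5 e, scals s 1 e))) // => e.
  by rewrite !out3 // -(s3s 1).
have s46 (i : 'I_n) : scals s4 6 i = c i by rewrite s4c s36s s2c.
have nnzB := output_size out'.
have c0V i : (c i)^-1 != 0 by rewrite invr_eq0.
exists (t1 + (t2 + (t + t4)))%N, s4, (map (scale (fun i => (c i)^-1)) B); split.
- exact: exec_Seq ex1 (exec_Seq ex2 (exec_Seq ex3 ex4)).
- apply: (output_scale out' c0') => //; try by move=> j; rewrite s4n.
  by move=> j lt; rewrite s4s // s4c.
- apply: sparsest_basis_scale minB => // x xN.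
    by rewrite -(Null_scaling MG r0 rcP) scaleVK.
  suff -> : scale (fun i => (c i)^-1^-1) x = scale c x by rewrite (Null_scaling MG r0 rcP).
  by apply/matrixP => i j; rewrite !scaleE invrK.
- rewrite nnz_scale //; have m2n := forest_size_nz_pos forG MG.
  rewrite nnzB in le4; rewrite -/k1 in le1; rewrite -/k2 in le2; rewrite -/k3 in le4.
  move: (size _) (nnz B) k1 k2 k3 m2n le1 le2 le le4 => m N k1 k2 k3 m2n le1 le2 le le4.
  clear -m2n le1 le2 le le4; set X := (n + N).+1 in le *.
  have : (k1 * m <= k1 * (2 * X))%N by rewrite leq_mul2l; apply/orP; right; rewrite /X; lia.
  have : (k2 * (2 * n + m) <= k2 * (4 * X))%N.
    by rewrite leq_mul2l; apply/orP; right; rewrite /X; lia.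
  have : (k3 * N <= k3 * X)%N by rewrite leq_mul2l; apply/orP; right; rewrite /X; lia.
  have : (0 < X)%N by []. 
  by move: X le => X le; nia.
Qed.

End Reduction.

Theorem mainTheorem3 (K : fieldType) :
  (forall (n : nat) (M : 'M[K]_n) (F : graph n),
     forest F -> in_M0 F M ->
   forall BF : seq 'cV[K]_n,
     sparsest_basis (Null (adjmx K F)) BF ->
   forall U : {set 'I_n}, choice_of_roots K F U ->
     sparsest_basis (Null M) [seq invmx (Dset M F U) *m b | b <- BF])
  /\
  ((exists P : cmd,
      finds_sparsest_basis_in_optimal_time (@forest_adjmx K) P) ->
   (exists P : cmd,
      finds_sparsest_basis_in_optimal_time (@acyclic_mx K) P)).
Proof.
split=> [n M F forF MF BF BFmin U UP|[P /acyclic_program PP]]; last by eexists; exact: PP.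
by apply: sparsest_basis_Dset.
Qed.
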